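(* For every $n\ge 1$, let $C_{\lambda_n,\mu_n}$ be a conjugacy class of the hyperoctahedral group $B_n$, and let $X_n$ be the descent statistic $\operatorname{des}_B$ regarded as a random variable on $C_{\lambda_n,\mu_n}$ with the uniform distribution. Suppose that for every $i$, the number of cycles of length $i$ in $\lambda_n$ and in $\mu_n$ approaches $0$ as $n\to\infty$. Then for all sufficiently large $n$, $X_n$ has mean $n/2$ and variance $(n+1)/12$, and as $n\to\infty$ the random variable $(X_n-n/2)/\sqrt{(n+1)/12}$ converges in distribution to a standard normal distribution.
   Context: $B_n$ is the group of permutations $\omega$ of $\{\pm1,\ldots,\pm n\}$ with $\omega(-i)=-\omega(i)$. For $\omega\in B_n$, $\operatorname{des}_B(\omega)=|\{i\in\{0,1,\ldots,n-1\}:\omega(i)>\omega(i+1)\}|$ with the convention $\omega(0)=0$ and the usual order on the integers. The underlying permutation $|\omega|\in\mathfrak{S}_n$ is $i\mapsto|\omega(i)|$; a cycle of $\omega$ is a cycle of $|\omega|$, and it is even (resp. odd) if the number of elements $i$ in it with $\omega(i)<0$ is even (resp. odd). The cycle type of $\omega$ is the bi-partition $(\lambda,\mu)$ where $\lambda$ lists the lengths of the even cycles and $\mu$ the lengths of the odd cycles; the conjugacy classes of $B_n$ are exactly the sets $C_{\lambda,\mu}$ of elements of a given cycle type. *)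

(* Defs.v *)
From HB Require Import structures.
From mathcomp Require Import all_boot all_order all_algebra all_fingroup.
From mathcomp Require Import all_classical all_reals all_analysis.

Set Implicit Arguments.
Unset Strict Implicit.
Unset Printing Implicit Defensive.

Import Order.TTheory GRing.Theory Num.Theory.
Import numFieldNormedType.Exports.

Local Open Scope ring_scope.

(* The set {±1, ..., ±n}: the pair (b, i) stands for (-1)^b (i + 1). *)
Definition signed (n : nat) : Type := (bool * 'I_n)%type.

Definition sint n (x : signed n) : int := (-1) ^+ x.1 * x.2.+1%:Z.

Definition sopp n (x : signed n) : signed n := (~~ x.1, x.2).

Definition spos n (i : 'I_n) : signed n := (false, i).

Lemma sint_sopp n (x : signed n) : sint (sopp x) = - sint x.
Proof.
by case: x => [[] i]; rewrite /sint /= ?expr0 ?expr1 ?mul1r ?mulN1r ?opprK.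
Qed.

Definition hyperoct (n : nat) : {set {perm signed n}} :=
  [set w : {perm signed n} | [forall x, w (sopp x) == sopp (w x)]].

Lemma hyperoct_group_set n : group_set (hyperoct n).
Proof.
apply/group_setP; split=> [|u v].
  by rewrite inE; apply/forallP => x; rewrite !perm1.
rewrite !inE => /forallP hu /forallP hv; apply/forallP => x.
by rewrite !permM (eqP (hu x)) (eqP (hv _)).
Qed.
Canonical hyperoct_group n := Group (hyperoct_group_set n).

(* The integer w(k) for 1 <= k <= n; it is 0 for k = 0 (the convention used
   for descents) and for k > n. *)
Definition sval_at n (w : {perm signed n}) (k : nat) : int :=
  if k is j.+1 then oapp (fun i : 'I_n => sint (w (spos i))) 0 (insub j) else 0.

Definition desB n (w : {perm signed n}) : nat :=
  #|[set i : 'I_n | sval_at w i > sval_at w i.+1]|.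

(* |w| : i |-> |w(i)|. This map is a permutation when w is in hyperoct n, see
   absperm_hyperoct; for other w the value is irrelevant. *)
Definition absperm n (w : {perm signed n}) : 'S_n :=
  insubd (1%g : 'S_n) [ffun i => (w (spos i)).2].

Lemma absperm_hyperoct n (w : {perm signed n}) (i : 'I_n) :
  w \in hyperoct n -> absperm w i = (w (spos i)).2.
Proof.
rewrite inE => /forallP hw.
suff inj : injectiveb [ffun i => (w (spos i)).2].
  by rewrite -pvalE /absperm insubdK // ffunE.
apply/injectiveP => j k; rewrite !ffunE => jk.
case: (eqVneq (w (spos j)).1 (w (spos k)).1) => [e|ne].
  suff /perm_inj[] : w (spos j) = w (spos k) by [].
  by move: e jk; case: (w (spos j)) (w (spos k)) => [? ?] [? ?] /= -> ->.
suff /perm_inj[] : w (spos j) = w (sopp (spos k)) by [].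
rewrite (eqP (hw _)); move: ne jk; rewrite /sopp.
by case: (w (spos j)) (w (spos k)) => [[] ?] [[] ?] //= _ ->.
Qed.

Definition odd_cycle n (w : {perm signed n}) (c : {set 'I_n}) : bool :=
  odd #|[set i in c | sint (w (spos i)) < 0]|.

(* Cycle lengths are listed in non-increasing order, fixed points included. *)
Definition even_type n (w : {perm signed n}) : seq nat :=
  sort geq [seq #|c| | c : {set 'I_n} in
    [set c in porbits (absperm w) | ~~ odd_cycle w c]].

Definition odd_type n (w : {perm signed n}) : seq nat :=
  sort geq [seq #|c| | c : {set 'I_n} in
    [set c in porbits (absperm w) | odd_cycle w c]].

(* C_{la,mu}: even cycles have lengths la, odd cycles have lengths mu. The set is
   empty unless la and mu are non-increasing lists of positive integers of total
   sum n. *)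
Definition cycle_class (n : nat) (la mu : seq nat) : {set {perm signed n}} :=
  [set w in hyperoct n | (even_type w == la) && (odd_type w == mu)].

Local Open Scope classical_set_scope.
Local Open Scope ring_scope.

HB.instance Definition _ (T : finType) := isPointed.Build (perm_type T) 1%g.
HB.instance Definition _ (T : finType) :=
  @isMeasurable.Build default_measure_display (perm_type T) discrete_measurable
    discrete_measurable0 discrete_measurableC discrete_measurableU.

Lemma measurable_perm (T : finType) (A : set {perm T}) : measurable A.
Proof. by []. Qed.

(* The uniform distribution on C when C is nonempty (see uniform_onE); the Dirac
   mass is the fallback value of mnormalize for C empty. *)
Definition uniform_on (R : realType) (T : finType) (C : {set {perm T}}) :
    probability {perm T} R :=
  mnormalize (mrestr (@counting {perm T} R) (measurable_perm [set` C]))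
    (dirac (1%g : {perm T})).

Lemma counting_perm (R : realType) (T : finType) (B : {set {perm T}}) :
  counting [set` B] = (#|B|%:R : R)%:E.
Proof.
rewrite /counting asboolT; last exact: finite_finset.
congr (_%:R%:E); rewrite cardE; apply/perm_size/uniq_perm.
- exact: finmap.fset_uniq.
- exact: enum_uniq.
move=> w; rewrite mem_enum [LHS]in_fset_set; last exact: finite_finset.
by rewrite mem_setE.
Qed.

Lemma uniform_onE (R : realType) (T : finType) (C : {set {perm T}})
    (A : set {perm T}) :
  (0 < #|C|)%N ->
  uniform_on R C A = (#|[set w in C | w \in A]|%:R / #|C|%:R)%:E.
Proof.
move=> C0.
have mE d (U : measurableType d) (nu : {measure set U -> \bar R})
    (P : probability U R) (r : R) B :
    nu setT = r%:E -> r != 0 -> mnormalize nu P B = (nu B * (r^-1)%:E)%E.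
  by move=> nuT r0; rewrite /mnormalize nuT eqe (negPf r0).
rewrite /uniform_on; etransitivity; first apply: (mE _ _ _ _ #|C|%:R).
- by rewrite -counting_perm -[in RHS](setTI [set` C]).
- by rewrite pnatr_eq0 -lt0n.
- rewrite [X in (X * _)%E](_ : _ = counting (A `&` [set` C])) //.
  rewrite (_ : A `&` _ = [set` [set w in C | w \in A]]%SET) ?counting_perm ?EFinM//.
  apply/seteqP; split => w /=; rewrite inE.
    by case=> /mem_set -> ->.
  by move=> /andP[? /set_mem].
Qed.

Section perm_rv.
Variables (R : realType) (T : finType).

Definition perm_rv (f : {perm T} -> R) : {perm T} -> R := f.

Lemma measurable_perm_rv f : measurable_fun setT (perm_rv f).
Proof. by []. Qed.

HB.instance Definition _ f :=
  isMeasurableFun.Build _ _ _ _ (perm_rv f) (measurable_perm_rv f).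
End perm_rv.

(* Convergence of the distribution functions at the continuity points of the
   limit. *)
Definition converges_in_distribution (R : realType) (d : nat -> measure_display)
    (T : forall n, measurableType (d n)) (P : forall n, probability (T n) R)
    (X : forall n, {RV (P n) >-> R}) (Q : probability (measurableTypeR R) R) : Prop :=
  forall x : R, {for x, continuous (fun y : R => Q `]-oo, y]%classic)} ->
    cdf (X n) x @[n --> \oo] --> Q `]-oo, x]%classic.

(* Main.v *)
(** For a set [J] of at most [m] positions and a class with all cycles longer than [2 m],
    the proportion of permutations without descent on [J] is [1 / |G|], where [G] is the
    group of signed permutations preserving the blocks of consecutive positions joined
    by [J]. Indeed [G] acts on the class by conjugation, and, as in the Gessel-Reutenauer
    correspondence, each [w] has exactly one [G]-conjugate ascending on every block:
    the one that sorts each block by the lexicographic order of the sequences of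
    blocks met along the orbits of [w]; long cycles visit singleton blocks, so these
    sequences separate points. A word with independent uniform letters in [-M, M],
    conditioned on being injective up to sign, has the same probability, so moments
    of order at most [m] of the descent number on the class are the limits, as [M]
    grows, of those for the unconditioned word.

    Writing a word as the partial sums modulo [N = 2 M + 1] of independent uniform
    increments [y_i], the sum of the [y_i] is [N] times the descent number plus a
    remainder in [-M, M]. This gives the exact mean and variance, and convergence of
    all normalized moments to Gaussian ones.

    The method of moments is carried out with test functions [Q (sin (a x + b))], [Q] a
    polynomial close to a step: they sandwich indicators of half-lines, and Taylor's
    formula approximates them by polynomials with small error in Gaussian mean. *)

Require Import Defs.
From HB Require Import structures.
From mathcomp Require Import all_boot all_order all_algebra all_fingroup.
From mathcomp Require Import all_classical all_reals all_analysis.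
From mathcomp Require Import measurable_realfun.
From mathcomp Require Import zify ring lra.

Set Implicit Arguments.
Unset Strict Implicit.
Unset Printing Implicit Defensive.

Import Order.TTheory GRing.Theory Num.Theory.
Import numFieldNormedType.Exports.

Local Open Scope ring_scope.

(** * Blocks and signed sorting *)

Section Rank.
Variable T : finType.
Implicit Type f : T -> int.

Definition rank f x := #|[set y | f y < f x]|.

Lemma ltn_rank f x y : (rank f x < rank f y)%N = (f x < f y).
Proof.
have [xy|yx] := ltP (f x) (f y).
  apply: proper_card; apply/properP; split.
    by apply/fintype.subsetP => z; rewrite !inE => /lt_trans; apply.
  by exists x; rewrite !inE // ltxx.
apply/negbTE; rewrite -leqNgt; apply/subset_leq_card/fintype.subsetP => z.
by rewrite !inE => /lt_le_trans; apply.
Qed.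

Lemma rank_lt_card f x : (rank f x < #|T|)%N.
Proof.
rewrite -cardsT; apply: proper_card; apply/properP; split; first exact: finset.subsetT.
by exists x; rewrite !inE // ltxx.
Qed.

Lemma rank_inj f : injective f -> injective (rank f).
Proof.
move=> fI x y xy; apply: fI; apply/eqP; rewrite eq_le.
by rewrite !leNgt -!ltn_rank xy ltnn.
Qed.

(** For an injective [f] the rank is a bijection onto an initial segment, so [g] is the rank of [f]
    followed by the inverse of the rank of [f']. *)
Lemma rank_match f f' : injective f -> injective f' ->
  exists g : {perm T}, forall x, rank f' (g x) = rank f x.
Proof.
move=> fI fI'.
pose r h x := Ordinal (rank_lt_card h x).
have rI h : injective h -> injective (r h).
  by move=> hI x y /(congr1 val) /= /rank_inj; apply.
have [s _ sK] : bijective (r f').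
  by apply: inj_card_bij; [exact: rI | rewrite card_ord].
have gI : injective (s \o r f).
  apply: inj_comp; last exact: rI.
  by apply: can_inj sK.
exists (perm gI) => x; rewrite permE /=.
by have /(congr1 val) := sK (r f x).
Qed.

Lemma rank_perm f (g : {perm T}) f0 :
  (forall x y, (f0 x < f0 y) = (f (g x) < f (g y))) ->
  forall x, rank f (g x) = rank f0 x.
Proof.
move=> fg x; rewrite /rank -(card_imset [set y | f0 y < f0 x] (@perm_inj _ g)).
apply: eq_card => z; rewrite inE; apply/idP/imsetP => [zx|[y]].
  by exists (g^-1%g z); rewrite ?permKV // inE fg permKV.
by rewrite inE fg => ? ->.
Qed.

End Rank.

Section Blocks.
Variables (n : nat) (J : {set 'I_n}).
Implicit Types (x y : signed n) (k : signed n -> int).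

(** A word indexed by 1..n is treated as an odd function on signed positions; this covers signed
    permutations and random words alike. *)
Definition odd_key k := forall x, k (sopp x) = - k x.

Lemma soppK : involutive (@sopp n).
Proof. by case=> b i; rewrite /sopp /= negbK. Qed.

Lemma odd_sint : odd_key (@sint n). Proof. exact: sint_sopp. Qed.

Lemma sint_inj : injective (@sint n).
Proof.
move=> [b i] [c j]; rewrite /sint /=.
case: b c => [] []; rewrite ?expr0 ?expr1 ?mul1r ?mulN1r => e;
  congr pair; try (apply: val_inj => /=); lia.
Qed.

(* Positions [s] and [t] are in the same block of consecutive positions joined by
   elements of [J] iff [lev s = lev t]; [lab] extends this to negative positions. *)
Definition lev (t : nat) : nat := #|[set s : 'I_n | (s < t)%N && (s \notin J)]|.

Lemma lev0 : lev 0 = 0%N.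
Proof. by apply/eqP; rewrite cards_eq0; apply/eqP/setP => s; rewrite !inE. Qed.

Lemma leq_lev s t : (s <= t)%N -> (lev s <= lev t)%N.
Proof.
move=> st; apply/subset_leq_card/fintype.subsetP => u; rewrite !inE => /andP[us ->].
by rewrite (leq_trans us).
Qed.

Lemma ltn_lev (u : 'I_n) s t : u \notin J -> (s <= u < t)%N -> (lev s < lev t)%N.
Proof.
move=> uJ /andP[su ut]; apply/proper_card/properP; split.
  apply/fintype.subsetP => v; rewrite !inE => /andP[vs ->].
  by rewrite (leq_trans vs) // (leq_trans su) // ltnW.
by exists u; rewrite !inE ?ut ?uJ // ltnNge su.
Qed.

Lemma lev_eq s t : lev s = lev t ->
  forall u : 'I_n, (s <= u < t)%N -> u \in J.
Proof.
move=> e u sut; apply: contraT => uJ.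
by have := ltn_lev uJ sut; rewrite e ltnn.
Qed.

Lemma levS (u : 'I_n) : u \in J -> lev u.+1 = lev u.
Proof.
move=> uJ; apply: eq_card => v; rewrite !inE ltnS leq_eqVlt.
by have [/val_inj ->|] //= := eqVneq (v : nat) u; rewrite ltnn uJ.
Qed.

Lemma lev_le t : (lev t <= n)%N.
Proof. by rewrite -[X in (_ <= X)%N]card_ord max_card. Qed.

Definition lab x : int := (-1) ^+ x.1 * (lev x.2.+1)%:Z.

Lemma odd_lab : odd_key lab.
Proof.
by case=> [[] i]; rewrite /lab /= ?expr0 ?expr1 ?mul1r ?mulN1r ?opprK.
Qed.

Lemma lab_bound x : `|lab x| <= n%:Z.
Proof.
rewrite /lab normrM normrX normrN1 expr1n mul1r ger0_norm //.
by rewrite lez_nat lev_le.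
Qed.

Lemma lab_mono x y : sint x < sint y -> lab x <= lab y.
Proof.
case: x y => [b i] [c j]; rewrite /sint /lab /=.
case: b c => [] []; rewrite ?expr0 ?expr1 ?mul1r ?mulN1r => e.
- rewrite lerN2 lez_nat leq_lev //; lia.
- lia.
- lia.
- rewrite lez_nat leq_lev //; lia.
Qed.

(* [sval_at w] is [key_at (sint \o w)]. *)
Definition key_at k (t : nat) : int :=
  if t is j.+1 then oapp (fun i : 'I_n => k (spos i)) 0 (insub j) else 0.

Lemma key_atS k (i : 'I_n) : key_at k i.+1 = k (spos i).
Proof. by rewrite /= valK. Qed.

Definition asc_at k (t : 'I_n) : bool := key_at k t < key_at k t.+1.

Definition ascending k : bool := [forall t in J, asc_at k t].

Definition block_ascending k :=
  forall x y, lab x = lab y -> sint x < sint y -> k x < k y.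

Lemma ascending_chain k s t : ascending k -> lev s = lev t -> (s < t <= n)%N ->
  key_at k s < key_at k t.
Proof.
move=> /forallP/= ka; elim: t => // t IH e /andP[st tn].
have tJ : Ordinal tn \in J by apply: (lev_eq e) => /=; lia.
have := ka (Ordinal tn); rewrite tJ /= /asc_at /= => kt.
move: st; rewrite ltnS leq_eqVlt => /orP[/eqP ->//|st].
apply: lt_trans kt; apply: IH; last by lia.
by rewrite e; exact: (levS tJ).
Qed.

(** Single steps chain along each block. Positions of opposite sign share a label only in the block
    around 0, where ascending from the value 0 makes the positive side positive and, by oddness, the
    negative side negative. *)
Lemma ascendingP k : odd_key k -> reflect (block_ascending k) (ascending k).
Proof.
move=> ko; apply: (iffP idP) => [ka [b i] [c j]|kb].
  rewrite /lab /sint /=.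
  have kt d (l : 'I_n) : k (d, l) = (-1) ^+ d * key_at k l.+1.
    rewrite key_atS; case: d; rewrite ?expr0 ?expr1 ?mul1r // mulN1r -ko //.
  rewrite !kt.
  case: b c => [] []; rewrite ?expr0 ?expr1 ?mul1r ?mulN1r => e lt_ij.
  - rewrite ltrN2; apply: ascending_chain => //; first by lia.
    by have := ltn_ord i; lia.
  - have i0 : lev i.+1 = 0%N by lia.
    have j0 : lev j.+1 = 0%N by lia.
    have pos (l : 'I_n) : lev l.+1 = 0%N -> 0 < key_at k l.+1.
      by move=> l0; apply: (@ascending_chain k 0); rewrite ?lev0 ?l0 ?ltn_ord.
    by apply: lt_trans (pos _ j0); rewrite oppr_lt0 pos.
  - lia.
  - apply: ascending_chain => //; first by lia.
    by have := ltn_ord j; lia.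
apply/forallP => -[[|t] tn]; apply/implyP => tJ; rewrite /asc_at /=.
  have l0 : lev 1 = 0%N by rewrite (levS tJ) lev0.
  rewrite (_ : insub 0%N = Some (Ordinal tn)) ?insubT //=.
  (* Comparing positions -1 and 1 gives -k(1) < k(1), which is the ascent from 0. *)
  have := kb (sopp (spos (Ordinal tn))) (spos (Ordinal tn)).
  rewrite ko /lab /sint /sopp /spos /= l0; lia.
have tn' := ltnW tn.
rewrite !insubT /=; apply: kb; rewrite /lab /sint /=; last by lia.
by rewrite -[in RHS]/(lev (Ordinal tn).+1) (levS tJ).
Qed.

(** A product of symmetric groups and, for the block around 0, of a hyperoctahedral group. *)
Definition block_perms : {set {perm signed n}} :=
  [set g in hyperoct n | [forall x, lab (g x) == lab x]].

Lemma block_permsP g : reflect ((g \in hyperoct n) /\ forall x, lab (g x) = lab x)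
  (g \in block_perms).
Proof.
rewrite [_ \in block_perms]inE; apply: (iffP andP) => -[-> gl]; split => //.
  by move=> x; apply/eqP/(forallP gl).
by apply/forallP => x; apply/eqP.
Qed.

Lemma hyperoctP (g : {perm signed n}) :
  reflect (forall x, g (sopp x) = sopp (g x)) (g \in hyperoct n).
Proof.
by rewrite inE; apply: (iffP forallP) => h x; apply/eqP.
Qed.

Definition lab_monotone (f : signed n -> int) := forall x y, lab x < lab y -> f x < f y.

(** Ordering by [f] refines ordering by label, so the positions with label below [c] form an initial
    segment; the rank thus determines the label. *)
Lemma lab_rank f x (c : int) : lab_monotone f ->
  (c <= lab x) = (#|[set y | (lab y < c)%R]| <= rank f x)%N.
Proof.
move=> fm; have [cx|xc] := leP c (lab x).
  apply/esym/subset_leq_card/fintype.subsetP => y; rewrite !inE => yc.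
  exact/fm/(lt_le_trans yc).
apply/esym/negbTE; rewrite -ltnNge; apply/proper_card/properP; split.
  apply/fintype.subsetP => y; rewrite !inE => yx.
  rewrite (le_lt_trans _ xc) // leNgt; apply/negP => /fm.
  by rewrite ltNge (ltW yx).
by exists x; rewrite !inE // ltxx.
Qed.

Lemma rank_sopp f x : odd_key f ->
  rank f (sopp x) = #|[set y | f x < f y]|.
Proof.
move=> fo; rewrite /rank -(card_imset _ (inv_inj soppK)).
apply: eq_card => z; rewrite !inE; apply/imsetP/idP => [[y]|xz].
  by rewrite inE fo => yx ->; rewrite fo ltrNr.
by exists (sopp z); rewrite ?soppK // inE !fo ltrN2.
Qed.

(* Each orbit of the block group contains exactly one key that ascends on
   every block: sort each block. *)
Lemma unique_sorting k : odd_key k -> injective k ->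
  #|[set g in block_perms | ascending (k \o g)]| = 1%N.
Proof.
move=> ko kI.
have [b kb] : exists b : int, forall x, `|k x| < b.
  exists (\sum_x `|k x| + 1) => x; rewrite ltzD1 (bigD1 x) //= lerDl.
  by apply: sumr_ge0 => *.
(* As [b] exceeds every |k|, [f] compares labels first and [k] inside a block. *)
pose f x := 2 * b * lab x + k x.
have fo : odd_key f by move=> x; rewrite /f odd_lab ko mulrN opprD.
have fm : lab_monotone f.
  move=> x y xy; rewrite /f; have := kb x; have := kb y.
  move: (lab x) (lab y) (k x) (k y) xy => lx ly kx ky xy; nia.
have f_eq x y : lab x = lab y -> (f x < f y) = (k x < k y).
  by move=> e; rewrite /f e ltrD2l.
have fI : injective f.
  move=> x y; case: (ltgtP (lab x) (lab y)) => [/fm|/fm|]; try lia.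
  by rewrite /f => -> /addrI /kI.
have sm : lab_monotone (@sint n).
  move=> x y xy; rewrite ltNge; apply/negP.
  rewrite le_eqVlt => /orP[/eqP/sint_inj e|/lab_mono]; last by rewrite leNgt xy.
  by rewrite e ltxx in xy.
(* A sorting [g] carries the order of [sint] to that of [f], so ranks determine it: this is
   uniqueness. *)
have char g : g \in block_perms -> ascending (k \o g) ->
    forall x, rank f (g x) = rank (@sint n) x.
  move=> /block_permsP[/hyperoctP go gl] ka; apply: rank_perm.
  have kgo : odd_key (k \o g) by move=> x /=; rewrite go ko.
  have mono x y : sint x < sint y -> f (g x) < f (g y).
    move=> xy; have := lab_mono xy; rewrite le_eqVlt => /orP[/eqP e|].
      by rewrite f_eq ?gl //; apply: (ascendingP kgo ka).
    by rewrite -(gl x) -(gl y); apply: fm.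
  move=> x y; apply/idP/idP => [/mono//|]; case: (ltgtP (sint x) (sint y)) => // [/mono|/sint_inj ->].
    by move=> h1 h2; have := lt_trans h1 h2; rewrite ltxx.
  by rewrite ltxx.
have [g gr] := rank_match sint_inj fI.
have glt x y : (f (g x) < f (g y)) = (sint x < sint y).
  by rewrite -!ltn_rank !gr.
(* Both orders refine the order of labels, so equal ranks force equal labels. *)
have gl x : lab (g x) = lab x.
  apply/eqP; rewrite eq_le (lab_rank _ _ sm) -gr -(lab_rank _ _ fm) lexx /=.
  by rewrite (lab_rank _ _ fm) gr -(lab_rank _ _ sm).
(* For odd keys, passing to the opposite exchanges ranks counted from below and from above. *)
have go : g \in hyperoct n.
  apply/hyperoctP => x; apply: (rank_inj fI); rewrite gr !rank_sopp //; last exact: odd_sint.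
  rewrite -(card_imset _ (@perm_inj _ g)); apply: eq_card => z; rewrite inE.
  apply/imsetP/idP => [[y]|xz]; first by rewrite inE -glt => ? ->.
  by exists (g^-1%g z); rewrite ?permKV // inE -glt permKV.
have gB : g \in block_perms by apply/block_permsP.
have kgo : odd_key (k \o g) by move=> x /=; rewrite (hyperoctP _ go) ko.
apply/eqP/cards1P; exists g; apply/setP => h; rewrite inE [RHS]inE.
apply/andP/eqP => [[hB ha]|->].
  by apply/permP => x; apply: (rank_inj fI); rewrite char // gr.
split; first by have := gB; rewrite inE.
by apply/(ascendingP kgo) => x y e xy /=; rewrite -f_eq ?gl // glt.
Qed.

End Blocks.

(** * Conjugation by the block group *)

Section WordKey.
Variables (n : nat) (J : {set 'I_n}).
Implicit Types (w g : {perm signed n}) (x y : signed n).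

Local Notation lab := (lab J).
Local Notation B := (2 * n.+1)%:Z.

(* The labels along the orbit of [x] are digits in base [B], so that comparing keys
   compares label sequences lexicographically. *)
Fixpoint word_key w (m : nat) x : int :=
  if m is m'.+1 then B * word_key w m' x + lab ((w ^+ m')%g x) else 0.

(** [word_key] appends a last digit; this form splits off the leading one. *)
Lemma word_keyS w m x : word_key w m.+1 x = lab x * B ^+ m + word_key w m (w x).
Proof.
elim: m => [|m IH]; first by rewrite /= mulr0 expr0 mulr1 expg0 perm1 addr0 add0r.
rewrite [LHS]/= -/(word_key w m.+1 x) IH exprS mulrDr [X in _ = _ + X]/=.
by rewrite -permM -expgS; ring.
Qed.

(** Geometric series with digits bounded by [n]. As B - 1 is 2n + 1, the key stays within half of
    B^m - 1, so lower digits cannot outweigh a leading one. *)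
Lemma word_key_bound w m x : `|word_key w m x| * (B - 1) <= n%:Z * (B ^+ m - 1).
Proof.
elim: m => [|m IH] /=; first by rewrite normr0 mul0r expr0 subrr mulr0.
have B0 : 0 <= B by [].
have B1 : 0 <= B - 1 by lia.
apply: (@le_trans _ _ ((B * `|word_key w m x| + n%:Z) * (B - 1))).
  rewrite ler_wpM2r // (le_trans (ler_normD _ _)) // lerD ?lab_bound //.
  by rewrite normrM (ger0_norm B0).
rewrite mulrDl -mulrA exprS.
have h : B * (`|word_key w m x| * (B - 1)) <= B * (n%:Z * (B ^+ m - 1)) by rewrite ler_wpM2l.
apply: le_trans (lerD h (lexx _)) _.
by rewrite le_eqVlt; apply/orP; left; apply/eqP; ring.
Qed.

Definition cycle_key w := word_key w #[w]%g.

(** The label sequence has period [#[w]], so multiplication by [B] rotates the digits, moving the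
    leading [lab x] to the end. *)
Lemma cycle_keyE w x :
  B * cycle_key w x = cycle_key w (w x) + lab x * (B ^+ #[w]%g - 1).
Proof.
have := word_keyS w #[w]%g x; rewrite /= -/(cycle_key w x) expg_order perm1.
rewrite -/(cycle_key w (w x)) => e.
by apply/eqP; rewrite mulrBr mulr1 addrA eq_sym subr_eq e addrC.
Qed.

Lemma cycle_key_mono w : lab_monotone J (cycle_key w).
Proof.
move=> x y xy.
have bnd z := word_key_bound w #[w]%g z.
have := bnd (w x); have := bnd (w y).
have := cycle_keyE w x; have := cycle_keyE w y; rewrite /cycle_key.
have B1 : 1 < B by lia.
have : 1 < B ^+ #[w]%g :> int by rewrite exprn_egt1 //; case: #[w]%g (order_gt0 w).
move: (word_key w _ x) (word_key w _ y) (word_key w _ (w x)) (word_key w _ (w y)).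
move: (B ^+ _) (lab x) (lab y) xy => P lx ly xy kx ky kwx kwy P1 ey ex by_ bx.
have Bn : B - 1 = 2 * n%:Z + 1 by lia.
rewrite Bn in bx by_.
rewrite -(@ltr_pM2l _ B) // ex ey.
(* The rotated keys are below half of P - 1 in absolute value, while distinct labels contribute at
   least P - 1. *)
have small (z : int) : `|z| * (2 * n%:Z + 1) <= n%:Z * (P - 1) -> `|z| * 2 < P - 1.
  move=> h; rewrite -(@ltr_pM2r _ (2 * n%:Z + 1)) //.
  by move: h P1; set a := `|z|; lia.
have ax := small _ bx; have ay := small _ by_.
have : P - 1 <= ly * (P - 1) - lx * (P - 1).
  by rewrite -mulrBl ler_peMl; lia.
lia.
Qed.

Lemma cycle_key_step w x y : lab x = lab y ->
  (cycle_key w x < cycle_key w y) = (cycle_key w (w x) < cycle_key w (w y)).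
Proof.
by move=> e; rewrite -(@ltr_pM2l _ B) // !cycle_keyE e ltrD2r.
Qed.

Lemma cycle_key_eq w x y : cycle_key w x = cycle_key w y ->
  lab x = lab y /\ cycle_key w (w x) = cycle_key w (w y).
Proof.
move=> e; have exy : lab x = lab y.
  by case: (ltgtP (lab x) (lab y)) => // /(@cycle_key_mono w); rewrite e ltxx.
split => //; have := cycle_keyE w x; rewrite e exy cycle_keyE.
by move=> /addIr.
Qed.

Lemma cycle_key_lab w x y j : cycle_key w x = cycle_key w y ->
  lab ((w ^+ j)%g x) = lab ((w ^+ j)%g y).
Proof.
elim: j x y => [|j IH] x y e; have [exy ewxy] := cycle_key_eq e.
  by rewrite expg0 !perm1.
by rewrite expgS !permM; apply: IH.
Qed.

Lemma lab_eq_lev b c (i j : 'I_n) : lab (b, i) = lab (c, j) ->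
  lev J i.+1 = lev J j.+1 /\ ((0 < lev J i.+1)%N -> b = c).
Proof.
by rewrite /lab /=; case: b c => [] []; rewrite ?expr0 ?expr1 ?mul1r ?mulN1r; lia.
Qed.

(** An element t of [J] joins positions t and t + 1, and index i stands for position i + 1. The
    assumptions on [x.2] and [x.2.+1] thus say that [x] is alone in its block. *)
Lemma lab_isolated x y : x.2 \notin J -> (forall t : 'I_n, t \in J -> t != x.2.+1 :> nat) ->
  lab x = lab y -> x = y.
Proof.
case: x y => [b i] [c j] /= iJ iJ1 /lab_eq_lev[e bc].
have i0 : (0 < lev J i.+1)%N.
  by rewrite -(lev0 J); apply: (ltn_lev iJ); rewrite /= ltnSn.
rewrite (bc i0); congr pair; apply/val_inj.
case: (ltngtP i j) => // [ij|ji].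
  have i1n : (i.+1 < n)%N by rewrite (leq_ltn_trans ij) ?ltn_ord.
  have i1J : Ordinal i1n \notin J by apply/negP => /iJ1; rewrite eqxx.
  have := @ltn_lev _ J _ i.+1 j.+1 i1J; rewrite /= e ltnn; lia.
have := @ltn_lev _ J _ j.+1 i.+1 iJ; rewrite /= e ltnn; lia.
Qed.

Lemma absperm_expg w x j : w \in hyperoct n ->
  ((w ^+ j)%g x).2 = (absperm w ^+ j)%g x.2.
Proof.
move=> wh; elim: j x => [|j IH] x; first by rewrite !expg0 !perm1.
rewrite !expgS !permM IH; congr ((absperm w ^+ j)%g _).
rewrite (absperm_hyperoct _ wh).
case: x => [[] i] //.
by rewrite -[(true, i)]/(sopp (spos i)) (hyperoctP _ wh).
Qed.

Definition long_cycles w (m : nat) :=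
  forall i : 'I_n, (m < #|porbit (absperm w) i|)%N.

Lemma cycle_key_inj w : w \in hyperoct n -> long_cycles w (2 * #|J|) ->
  injective (cycle_key w).
Proof.
move=> wh wl x y e.
(* The indices whose position is joined to a neighbour: at most two for each element of [J]. *)
pose S := J :|: [set i : 'I_n | [exists t in J, t == i.+1 :> nat]].
have cS : (#|S| <= 2 * #|J|)%N.
  rewrite mul2n -addnn (leq_trans (leq_card_setU _ _)) // leq_add2l.
  pose f (t : 'I_n) := Ordinal (leq_ltn_trans (leq_pred t) (ltn_ord t)).
  apply: leq_trans (leq_imset_card f (mem J)); apply/subset_leq_card/fintype.subsetP => i.
  rewrite inE => /existsP[t /andP[tJ /eqP ti]]; apply/imsetP; exists t => //.
  by apply: val_inj; rewrite /= ti.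
(* A cycle longer than |S| leaves [S]. There the label identifies the point, and the equality is
   pulled back along the orbit. *)
have [k kO kS] : exists2 k, k \in porbit (absperm w) x.2 & k \notin S.
  apply/subsetPn/negP => /subset_leq_card; rewrite leqNgt.
  by rewrite (leq_ltn_trans cS).
have /porbitP[j kj] := kO.
apply: (@perm_inj _ (w ^+ j)%g); apply: lab_isolated; last exact: cycle_key_lab.
  by rewrite absperm_expg // -kj; apply: contra kS; rewrite inE => ->.
move=> t tJ; rewrite absperm_expg // -kj; apply: contra kS => tk.
by rewrite !inE; apply/orP; right; apply/existsP; exists t; rewrite tJ.
Qed.

Lemma cycle_key_odd w : w \in hyperoct n -> odd_key (cycle_key w).
Proof.
move=> wh x; rewrite /cycle_key; elim: #[w]%g => [|m IH] /=; first by rewrite oppr0.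
have -> : ((w ^+ m)%g (sopp x)) = sopp ((w ^+ m)%g x).
  by apply/hyperoctP; rewrite groupX.
by rewrite IH odd_lab mulrN opprD.
Qed.

(* If [w] ascends on [J] but some block has [x < y] with [key y < key x], then the
   labels of the two orbits agree forever, and the keys are equal. *)
Lemma ascending_cycle_key w : w \in hyperoct n -> injective (cycle_key w) ->
  ascending J (@sint n \o w) = ascending J (cycle_key w).
Proof.
move=> wh kI.
have so : odd_key (@sint n \o w) by move=> x /=; rewrite (hyperoctP _ wh) sint_sopp.
have ko := cycle_key_odd wh.
apply/idP/idP => [/(ascendingP J so) wa|/(ascendingP J ko) ka];
  [apply/(ascendingP J ko) | apply/(ascendingP J so)] => x y exy xy /=.
  rewrite ltNge le_eqVlt; apply/negP => /orP[/eqP/kI e|].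
    by rewrite e ltxx in xy.
  move=> kyx; suff e : cycle_key w x = cycle_key w y by rewrite e ltxx in kyx.
  have same j : lab ((w ^+ j)%g x) = lab ((w ^+ j)%g y).
    elim: j x y exy xy kyx => [|j IH] x y exy xy kyx; first by rewrite expg0 !perm1.
    have xy1 := wa _ _ exy xy.
    have kyx1 : cycle_key w (w y) < cycle_key w (w x) by rewrite -cycle_key_step.
    rewrite expgS !permM; apply: IH => //.
    apply/eqP; rewrite eq_le lab_mono //= leNgt; apply/negP => /(cycle_key_mono w).
    by rewrite ltNge (ltW kyx1).
  by rewrite /cycle_key; elim: #[w]%g => //= m ->; rewrite same.
(* Converse: if the images of x < y were in the wrong order, either they would share a block, where
   keys ascend, or their labels would already order the keys; both contradict [kw]. *)
have := ka _ _ exy xy; rewrite cycle_key_step // => kw.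
case: (ltgtP (sint (w x)) (sint (w y))) => // [|/sint_inj/perm_inj e]; last first.
  by rewrite e ltxx in xy.
move=> yx; have := lab_mono J yx; rewrite le_eqVlt => /orP[/eqP e|/cycle_key_mono h].
  by have := lt_trans kw (ka _ _ e yx); rewrite ltxx.
by have := lt_trans kw (h w); rewrite ltxx.
Qed.

(** As [g] preserves labels, the orbit of [x] under the conjugate reads the same labels as the orbit
    of [g x] under [w]. *)
Lemma cycle_key_conj w g x : g \in block_perms J ->
  cycle_key (w ^ g^-1)%g x = cycle_key w (g x).
Proof.
move=> /block_permsP[_ gl]; rewrite /cycle_key orderJ.
elim: #[w]%g => //= m ->; congr (_ + _).
by rewrite -conjXg conjgE invgK !permM -gl permKV.
Qed.

(** Double counting of pairs (w, g) with an ascending conjugate: each [w] has exactly one such [g],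
    and each [g] permutes [C] by conjugation. *)
Lemma card_ascending_class (C : {set {perm signed n}}) :
    C \subset hyperoct n ->
    (forall w g, g \in hyperoct n -> ((w ^ g)%g \in C) = (w \in C)) ->
    (forall w, w \in C -> long_cycles w (2 * #|J|)) ->
  (#|[set w in C | ascending J (@sint n \o w)]| * #|block_perms J| = #|C|)%N.
Proof.
move=> /fintype.subsetP CH CJ Cl.
have GH g : g \in block_perms J -> g \in hyperoct n by case/block_permsP.
pose a w : nat := ascending J (@sint n \o w).
have one w : w \in C -> (\sum_(g in block_perms J) a (w ^ g^-1)%g = 1)%N.
  move=> wC; have wH := CH _ wC; have kI := cycle_key_inj wH (Cl _ wC).
  rewrite -(unique_sorting J (cycle_key_odd wH) kI) -sum1dep_card big_mkcondr /=.
  apply: eq_bigr => g gG; have cI : injective (cycle_key (w ^ g^-1)%g).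
    by move=> x y; rewrite !cycle_key_conj // => /kI/perm_inj.
  rewrite /a ascending_cycle_key //; last first.
    by apply: CH; rewrite CJ // groupV GH.
  suff -> : cycle_key (w ^ g^-1)%g = cycle_key w \o g by case: ascending.
  by apply/funext => x; exact: cycle_key_conj.
rewrite -[RHS]sum1_card -(eq_bigr _ one) exchange_big /= mulnC -sum_nat_const.
apply: eq_bigr => g gG; rewrite -sum1dep_card big_mkcondr /=.
rewrite [RHS](reindex_inj (@conjg_inj _ g)) /=; apply: eq_big => w.
  by rewrite CJ // GH.
by rewrite conjgK /a; case: ascending.
Qed.

End WordKey.

(** * Random words *)

Section Model.
Variables (n M : nat).
Local Notation V := 'I_(M.*2.+1).
Local Notation N := (M.*2.+1).
Implicit Types (x : {ffun 'I_n -> V}) (v u : V) (g : {perm signed n}).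

(* The representative of [v] modulo [2 M + 1] in [-M, M]. *)
Definition cent v : int := if (v <= M)%N then v%:Z else v%:Z - N%:Z.

Lemma cent_inj : injective cent.
Proof.
move=> u v; rewrite /cent => e; apply: val_inj => /=.
have := ltn_ord u; have := ltn_ord v.
by move: e; case: (leqP u M) => uM; case: (leqP v M) => vM; lia.
Qed.

Lemma cent_bound v : `|cent v| <= M%:Z.
Proof. by have := ltn_ord v; rewrite /cent; case: (leqP v M) => vM; lia. Qed.

Lemma centN v : cent (- v) = - cent v.
Proof.
have := ltn_ord v; rewrite /cent /=.
have [->|v0 vN] := posnP v; first by rewrite subn0 modnn.
by rewrite modn_small; [case: (leqP (N - v)%N M) => h; case: (leqP v M) => h'; lia | lia].
Qed.

Lemma cent0 : cent 0 = 0.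
Proof. by rewrite /cent. Qed.

(** Reducing a difference to [0, N) adds N exactly when the centered difference is negative: a
    descent is a carry. *)
Lemma val_centB v u :
  (nat_of_ord (v - u))%:Z = cent v - cent u + N%:Z * (cent v < cent u)%R%:Z.
Proof.
have := ltn_ord v; have := ltn_ord u.
rewrite /cent /=.
have -> : ((v + (N - u) %% N) %% N)%N = if (u <= v)%N then (v - u)%N else (v + N - u)%N.
  rewrite modnDmr; case: leqP => uv.
    by rewrite (_ : (v + (N - u) = v - u + N)%N) ?modnDr ?modn_small //; have := ltn_ord u; have := ltn_ord v; lia.
  by rewrite modn_small; have := ltn_ord u; have := ltn_ord v; lia.
case: (leqP u v) => h1 h2 h3; case: (leqP v M) => h4; case: (leqP u M) => h5;
  case: ltP => h6; lia.
Qed.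

Definition sample_key x : signed n -> int := fun s => (-1) ^+ s.1 * cent (x s.2).

Lemma sample_key_odd x : odd_key (sample_key x).
Proof.
by case=> [[] i]; rewrite /sample_key /= ?expr0 ?expr1 ?mul1r ?mulN1r ?opprK.
Qed.

Lemma sample_key_spos x i : sample_key x (spos i) = cent (x i).
Proof. by rewrite /sample_key expr0 mul1r. Qed.

Definition sample_act g x : {ffun 'I_n -> V} :=
  [ffun i => let s := g (spos i) in if s.1 then - x s.2 else x s.2].

Lemma sample_key_act g x : g \in hyperoct n ->
  sample_key (sample_act g x) = sample_key x \o g.
Proof.
move=> gH; apply/funext.
have pos i : sample_key (sample_act g x) (spos i) = sample_key x (g (spos i)).
  rewrite sample_key_spos ffunE /sample_key.
  by case: (g (spos i)) => [[] j] /=; rewrite ?centN ?expr0 ?expr1 ?mul1r ?mulN1r.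
case=> [[] i] /=; last exact: pos.
by rewrite -[(true, i)]/(sopp (spos i)) sample_key_odd (hyperoctP _ gH) sample_key_odd pos.
Qed.

Lemma sample_key_inj : injective sample_key.
Proof.
move=> x y e; apply/ffunP => i; apply: cent_inj.
by rewrite -!sample_key_spos e.
Qed.

Lemma sample_act_inj g : g \in hyperoct n -> injective (sample_act g).
Proof.
move=> gH x y e; apply: sample_key_inj; apply/funext => s.
have := congr1 (fun z => sample_key z (g^-1%g s)) e.
by rewrite /= !sample_key_act //= permKV.
Qed.

(** Injectivity on signed positions means nonzero letters with distinct absolute values. *)
Definition generic : {set {ffun 'I_n -> V}} := [set x | injectiveb (sample_key x)].

Lemma genericP x : reflect (injective (sample_key x)) (x \in generic).
Proof. by rewrite inE; apply: injectiveP. Qed.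

Lemma sample_act_generic g x : g \in hyperoct n ->
  (sample_act g x \in generic) = (x \in generic).
Proof.
move=> gH; apply/genericP/genericP; rewrite sample_key_act // => xI.
  move=> s t e; rewrite -[s](permKV g) -[t](permKV g); congr (g _); apply: xI.
  by rewrite /= !permKV.
by apply: inj_comp => //; exact: perm_inj.
Qed.

(** The same double counting as for a class, the block group now permuting and negating letters. *)
Lemma card_ascending_generic (J : {set 'I_n}) :
  (#|[set x in generic | ascending J (sample_key x)]| * #|block_perms J| = #|generic|)%N.
Proof.
have GH g : g \in block_perms J -> g \in hyperoct n by case/block_permsP.
pose a x : nat := ascending J (sample_key x).
have one x : x \in generic -> (\sum_(g in block_perms J) a (sample_act g x) = 1)%N.
  move=> /genericP xI.
  rewrite -(unique_sorting J (sample_key_odd x) xI) -sum1dep_card big_mkcondr /=.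
  apply: eq_bigr => g gG; rewrite /a sample_key_act ?GH //.
rewrite -[RHS]sum1_card -(eq_bigr _ one) exchange_big /= mulnC -sum_nat_const.
apply: eq_bigr => g gG; rewrite -sum1dep_card big_mkcondr /=.
rewrite (reindex_inj (@sample_act_inj g _)) ?GH //=; apply: eq_big => x.
  by rewrite sample_act_generic // GH.
by rewrite /a; case: (ascending J _).
Qed.

(** Overwriting letter [i] embeds the product of [S] and the alphabet into the set of all words. *)
Lemma card_determined (S : {set {ffun 'I_n -> V}}) i :
    {in S &, forall x y : {ffun 'I_n -> V}, (forall j, j != i -> x j = y j) -> x = y} ->
  (#|S| * N <= #|{ffun 'I_n -> V}|)%N.
Proof.
move=> Si.
pose f (p : {ffun 'I_n -> V} * V) : {ffun 'I_n -> V} :=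
  [ffun j => if j == i then p.2 else p.1 j].
rewrite -[X in (_ * X)%N](card_ord N) -cardsT -cardsX.
rewrite -(card_in_imset (f := f)); first exact: max_card.
move=> [x v] [y u]; rewrite !inE !andbT /= => xS yS /ffunP e.
have := e i; rewrite !ffunE eqxx /= => ->; congr pair; apply: Si => // j ji.
by have := e j; rewrite !ffunE (negPf ji).
Qed.

(** Union bound over pairs of signed positions: a collision determines one letter from the
    others. *)
Lemma card_nongeneric :
  (#|~: generic| * N <= (2 * n) ^ 2 * #|{ffun 'I_n -> V}|)%N.
Proof.
pose S (p : signed n * signed n) :=
  [set x | (p.1 != p.2) && (sample_key x p.1 == sample_key x p.2)].
have SN p : (#|S p| * N <= #|{ffun 'I_n -> V}|)%N.
  case: p => [[b i] [c j]]; apply: (@card_determined _ i) => x y.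
  rewrite !inE /= => /andP[ne /eqP ex] /andP[_ /eqP ey] exy.
  apply/ffunP => k; have [->|/exy//] := eqVneq k i; apply: cent_inj.
  move: ne ex ey; rewrite /sample_key /=; have [<-|/exy ->] := eqVneq j i.
    (* Same position with opposite signs: the letter is 0 in both words. *)
    by case: b c => [] []; rewrite ?eqxx //= ?expr0 ?expr1 ?mul1r ?mulN1r; lia.
  by case: b c => [] []; rewrite ?expr0 ?expr1 ?mul1r ?mulN1r; lia.
have cov : ~: generic \subset \bigcup_(p : signed n * signed n) S p.
  apply/fintype.subsetP => x; rewrite !inE => /injectivePn[s [t st e]].
  by apply/bigcupP; exists (s, t) => //; rewrite inE /= st e eqxx.
apply: (@leq_trans ((\sum_(p : signed n * signed n) #|S p|) * N)%N).
  rewrite leq_mul2r (leq_trans (subset_leq_card cov)) ?orbT //.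
  elim/big_rec2: _ => [|p A B _ h]; rewrite ?cards0 // (leq_trans (leq_card_setU _ _)) //.
  by rewrite leq_add2l.
rewrite big_distrl /=; apply: (@leq_trans (\sum_(p : signed n * signed n) #|{ffun 'I_n -> V}|)%N).
  by apply: leq_sum => p _; exact: SN.
by rewrite sum_nat_const !card_prod card_bool card_ord.
Qed.

End Model.

(** * Ascent counts, and the transfer of moments from classes to words *)

Section Counting.
Variable n : nat.
Implicit Types (k : signed n -> int).

Definition asc_count k := #|[set t : 'I_n | asc_at k t]|.
Definition des_count k := #|[set t : 'I_n | key_at k t > key_at k t.+1]|.

Lemma odd_key_neq0 k s : odd_key k -> injective k -> k s != 0.
Proof.
move=> ko kI; apply/eqP => k0.
have : sopp s = s by apply: kI; rewrite ko k0 oppr0.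
by case: s {k0} => [[] i].
Qed.

(** Injectivity excludes ties and, with oddness, also the value 0 at position 1. *)
Lemma asc_des_count k : odd_key k -> injective k -> (asc_count k + des_count k = n)%N.
Proof.
move=> ko kI; rewrite -[RHS]card_ord -(cardC [set t | asc_at k t]) /asc_count.
congr (_ + _)%N; apply: eq_card => t; rewrite !inE /asc_at -leNgt lt_neqAle.
case: eqP => // e; exfalso; move: e; case: t => -[|t] tn.
  rewrite key_atS /= => e; have /eqP := odd_key_neq0 (spos (Ordinal tn)) ko kI.
  by [].
have tn' := ltnW tn.
rewrite (key_atS k (Ordinal tn)) (key_atS k (Ordinal tn')) => /kI[] /=; lia.
Qed.

(** The m-th power counts m-tuples of ascents: a tuple [f] contributes when the key ascends on its
    image. *)
Lemma sum_asc_count (T : finType) (S : {set T}) (k : T -> signed n -> int) m :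
  (\sum_(w in S) asc_count (k w) ^ m =
   \sum_(f : {ffun 'I_m -> 'I_n}) #|[set w in S | ascending (f @: 'I_m) (k w)]|)%N.
Proof.
have E w : (asc_count (k w) ^ m =
    \sum_(f : {ffun 'I_m -> 'I_n}) ascending (f @: 'I_m) (k w))%N.
  rewrite /asc_count -sum1dep_card big_mkcond /=.
  rewrite -[X in (_ ^ X)%N](card_ord m) -prod_nat_const.
  rewrite bigA_distr_bigA /=; apply: eq_bigr => f _.
  have [/forallP a|na] := boolP (ascending _ _).
    rewrite big1 // => i _; have := a (f i); rewrite imset_f //= => ->.
    by [].
  have /forallPn[t] := na; rewrite negb_imply => /andP[/imsetP[i _ ->] nt].
  by rewrite (bigD1 i) //= (negPf nt).
rewrite (eq_bigr _ (fun w _ => E w)) exchange_big /=; apply: eq_bigr => f _.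
by rewrite -sum1dep_card big_mkcondr /=; apply: eq_bigr => w _; case: (ascending _ (k w)).
Qed.

(** Both normalized moments equal the sum over tuples of 1 / |G|, with G the block group of the
    image; cross-multiplying keeps the identity in the naturals. *)
Lemma sum_asc_count_proportional (T1 T2 : finType) (S1 : {set T1}) (S2 : {set T2})
    (k1 : T1 -> signed n -> int) (k2 : T2 -> signed n -> int) m :
    (forall J : {set 'I_n}, (#|J| <= m)%N ->
       #|[set w in S1 | ascending J (k1 w)]| * #|block_perms J| = #|S1|)%N ->
    (forall J : {set 'I_n}, (#|J| <= m)%N ->
       #|[set w in S2 | ascending J (k2 w)]| * #|block_perms J| = #|S2|)%N ->
  (#|S2| * (\sum_(w in S1) asc_count (k1 w) ^ m) =
   #|S1| * (\sum_(w in S2) asc_count (k2 w) ^ m))%N.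
Proof.
move=> h1 h2; rewrite !sum_asc_count !big_distrr /=; apply: eq_bigr => f _.
have fm : (#|f @: 'I_m| <= m)%N by rewrite (leq_trans (leq_imset_card _ _)) // card_ord.
by rewrite -[X in (X * _ = _)%N](h2 _ fm) -[X in (_ = X * _)%N](h1 _ fm); ring.
Qed.

End Counting.

Section ClassFacts.
Variables (n : nat) (la mu : seq nat).
Local Notation C := (cycle_class n la mu).

Lemma long_cycles_class m (w : {perm signed n}) :
    (forall i, (i <= m)%N -> (count_mem i la = 0%N) /\ (count_mem i mu = 0%N)) ->
  w \in C -> long_cycles w m.
Proof.
move=> h; rewrite inE => /andP[_ /andP[/eqP ela /eqP emu]] i.
rewrite ltnNge; apply/negP => /h[]; set c := porbit _ i => hla hmu.
have cP : c \in porbits (absperm w) by apply: imset_f.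
have [oc|ec] := boolP (odd_cycle w c).
  move/count_memPn: hmu; rewrite -emu /odd_type mem_sort => /negP; apply.
  by rewrite (map_f (fun d : {set 'I_n} => #|d|)) // mem_enum inE cP.
move/count_memPn: hla; rewrite -ela /even_type mem_sort => /negP; apply.
by rewrite (map_f (fun d : {set 'I_n} => #|d|)) // mem_enum inE cP.
Qed.

Hypothesis CH : C \in classes (hyperoct n).

Lemma cycle_class_gt0 : (0 < #|C|)%N.
Proof.
have /imsetP[w wH ->] := CH.
by apply/card_gt0P; exists w; rewrite class_refl.
Qed.

Lemma cycle_class_sub : C \subset hyperoct n.
Proof. by apply/fintype.subsetP => w; rewrite inE => /andP[]. Qed.

Lemma cycle_classJ w g : g \in hyperoct n -> ((w ^ g)%g \in C) = (w \in C).
Proof.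
move=> gH; have /imsetP[w0 wH ->] := CH.
by rewrite memJ_norm // (fintype.subsetP (class_norm _ _)).
Qed.

End ClassFacts.

Definition avg (R : realType) (T : finType) (S : {set T}) (f : T -> R) : R :=
  (\sum_(w in S) f w) / #|S|%:R.

Section Avg.
Variables (R : realType) (T : finType) (S : {set T}).
Hypothesis S0 : (0 < #|S|)%N.
Implicit Types f g : T -> R.

Let S0R : #|S|%:R != 0 :> R. Proof. by rewrite pnatr_eq0 -lt0n. Qed.

Lemma avgD f g : avg S (fun w => f w + g w) = avg S f + avg S g.
Proof. by rewrite /avg big_split mulrDl. Qed.

Lemma avgZ (c : R) f : avg S (fun w => c * f w) = c * avg S f.
Proof. by rewrite /avg -mulr_sumr mulrA. Qed.

Lemma avg_cst (c : R) : avg S (fun=> c) = c.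
Proof. by rewrite /avg sumr_const -[c *+ _]mulr_natr mulfK. Qed.

Lemma avg_le f g : (forall w, w \in S -> f w <= g w) -> avg S f <= avg S g.
Proof. by move=> fg; rewrite ler_pM2r ?ler_sum // invr_gt0 ltr0n. Qed.

Lemma avg_norm f : `|avg S f| <= avg S (fun w => `|f w|).
Proof.
rewrite /avg normrM (ger0_norm (x := #|S|%:R^-1)) ?invr_ge0 // ler_pM2r ?invr_gt0 ?ltr0n //.
exact: ler_norm_sum.
Qed.

End Avg.

(** The difference of averages is the average over [S] times |~: S|, minus the sum outside [S], all
    divided by |T|; each of the two terms is at most b |~: S|. *)
Lemma avg_restrict (R : realType) (T : finType) (S : {set T}) (f : T -> R) (b : R) :
    (0 < #|S|)%N -> (forall w, `|f w| <= b) ->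
  `|avg S f - avg [set: T] f| <= 2 * b * (#|~: S|%:R / #|T|%:R).
Proof.
move=> S0 fb.
have T0 : (0 < #|T|)%N by rewrite (leq_trans S0) // max_card.
have cE : #|~: S|%:R = #|T|%:R - #|S|%:R :> R.
  by rewrite -(cardsC S) natrD addrAC subrr add0r.
have split_sum : \sum_(w in [set: T]) f w = \sum_(w in S) f w + \sum_(w in ~: S) f w.
  rewrite (bigID (mem S)) /=; congr (_ + _); apply: eq_bigl => w; rewrite !inE //.
have b1 : `|\sum_(w in S) f w| <= b * #|S|%:R.
  rewrite (le_trans (ler_norm_sum _ _ _)) // mulr_natr -sumr_const.
  by apply: ler_sum => w _.
have b2 : `|\sum_(w in ~: S) f w| <= b * #|~: S|%:R.
  rewrite (le_trans (ler_norm_sum _ _ _)) // mulr_natr -sumr_const.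
  by apply: ler_sum => w _.
rewrite /avg split_sum cardsT.
move: b1 b2; set s := \sum_(w in S) f w; set r := \sum_(w in ~: S) f w => b1 b2.
have SR : (0 : R) < #|S|%:R by rewrite ltr0n.
have TR : (0 : R) < #|T|%:R by rewrite ltr0n.
have c0 : (0 : R) <= #|~: S|%:R by [].
have -> : s / #|S|%:R - (s + r) / #|T|%:R =
    (s / #|S|%:R * #|~: S|%:R - r) / #|T|%:R.
  by rewrite cE; field; rewrite !gt_eqF.
rewrite mulrA normrM (ger0_norm (x := #|T|%:R^-1)) ?invr_ge0 // ler_pM2r ?invr_gt0 //.
rewrite (le_trans (ler_normB _ _)) // mulr2n mulrDl mulrDl mul1r lerD //.
by rewrite normrM (ger0_norm c0) ler_wpM2r // normrM (ger0_norm (x := #|S|%:R^-1)) ?invr_ge0 // ler_pdivrMr.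
Qed.

Section Transfer.
Variables (R : realType) (n : nat).

Lemma asc_centered (k : signed n -> int) : odd_key k -> injective k ->
  (des_count k)%:R - n%:R / 2 = n%:R / 2 - (asc_count k)%:R :> R.
Proof.
by move=> ko kI; have := congr1 (fun t => t%:R : R) (asc_des_count ko kI); rewrite natrD; lra.
Qed.

(** Trading descents for ascents and expanding binomially reduces centered moments to the raw ascent
    moments that block counting compares. *)
Lemma sum_centered_pow (T : finType) (S : {set T}) (k : T -> signed n -> int) j :
    (forall w, w \in S -> odd_key (k w) /\ injective (k w)) ->
  \sum_(w in S) ((des_count (k w))%:R - n%:R / 2) ^+ j =
  \sum_(i < j.+1) (n%:R / 2) ^+ (j - i) * (-1) ^+ i * 'C(j, i)%:R *
     (\sum_(w in S) asc_count (k w) ^ i)%:R :> R.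
Proof.
move=> kS; transitivity (\sum_(w in S) \sum_(i < j.+1)
    (n%:R / 2) ^+ (j - i) * (-1) ^+ i * 'C(j, i)%:R * (asc_count (k w) ^ i)%:R : R).
  apply: eq_bigr => w /kS[ko kI]; rewrite asc_centered // exprDn; apply: eq_bigr => i _.
  rewrite (exprNn (asc_count (k w))%:R) natrX -[LHS]mulr_natr -!mulrA; congr (_ * (_ * _)); exact: mulrC.
rewrite exchange_big /=; apply: eq_bigr => i _.
by rewrite -mulr_sumr natr_sum.
Qed.

Lemma avg_class_generic (M : nat) (la mu : seq nat) m j :
    cycle_class n la mu \in classes (hyperoct n) ->
    (forall w, w \in cycle_class n la mu -> long_cycles w (2 * m)) ->
    (0 < #|generic n M|)%N -> (j <= m)%N ->
  avg (cycle_class n la mu) (fun w => ((desB w)%:R - n%:R / 2) ^+ j : R) =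
  avg (generic n M) (fun x => ((des_count (sample_key x))%:R - n%:R / 2) ^+ j).
Proof.
move=> CH Cl g0 jm; have C0 := cycle_class_gt0 CH.
have C0R : #|cycle_class n la mu|%:R != 0 :> R by rewrite pnatr_eq0 -lt0n.
have g0R : #|generic n M|%:R != 0 :> R by rewrite pnatr_eq0 -lt0n.
apply/eqP; rewrite /avg eqr_div //; apply/eqP.
rewrite (sum_centered_pow (S := cycle_class n la mu) (k := fun w => @sint n \o w)); last first.
  move=> w /(fintype.subsetP (cycle_class_sub n la mu)) wH; split.
    by move=> x /=; rewrite (hyperoctP _ wH) sint_sopp.
  by apply: inj_comp; [exact: sint_inj | exact: perm_inj].
rewrite sum_centered_pow; last by move=> x /genericP xI; split => //; exact: sample_key_odd.
rewrite !mulr_suml; apply: eq_bigr => i _.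
rewrite -!mulrA; congr (_ * (_ * (_ * _))).
rewrite -!natrM mulnC [in RHS]mulnC; congr (_%:R).
apply: sum_asc_count_proportional => J Jm.
  apply: card_ascending_class => [||w wC]; first exact: cycle_class_sub.
    by move=> w g; exact: cycle_classJ.
  by move=> t; apply: leq_ltn_trans (Cl _ wC t); rewrite leq_mul2l (leq_trans Jm) ?orbT // -ltnS (leq_trans (ltn_ord i)).
exact: card_ascending_generic.
Qed.

Lemma avg_class_model (M : nat) (la mu : seq nat) m j :
    cycle_class n la mu \in classes (hyperoct n) ->
    (forall w, w \in cycle_class n la mu -> long_cycles w (2 * m)) ->
    ((2 * n) ^ 2 < M)%N -> (j <= m)%N ->
  `|avg (cycle_class n la mu) (fun w => ((desB w)%:R - n%:R / 2) ^+ j : R) -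
   avg [set: {ffun 'I_n -> 'I_(M.*2.+1)}]
     (fun x => ((des_count (sample_key x))%:R - n%:R / 2) ^+ j)|
  <= 2 * n%:R ^+ j * ((2 * n) ^ 2)%:R / M%:R.
Proof.
move=> CH Cl nM jm.
have M0 : (0 < M)%N by apply: leq_ltn_trans nM.
have T0 : (0 < #|{ffun 'I_n -> 'I_(M.*2.+1)}|)%N.
  by rewrite card_ffun !card_ord expn_gt0.
have ng := card_nongeneric n M.
(* Were no word generic, the collision bound would give N <= (2n)^2. *)
have g0 : (0 < #|generic n M|)%N.
  rewrite lt0n; apply/negP => /eqP g0; move: ng.
  rewrite -(cardsC (generic n M)) g0 add0n leqNgt; move/negP; apply.
  move: T0; rewrite -(cardsC (generic n M)) g0 add0n mulnC => T0.
  by rewrite ltn_pmul2l //; lia.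
rewrite (avg_class_generic CH Cl g0 jm).
apply: le_trans (avg_restrict (b := n%:R ^+ j) g0 _) _ => [x|].
  rewrite normrX lerXn2r ?nnegrE //.
  have : (des_count (sample_key x))%:R <= n%:R :> R.
    by rewrite ler_nat -[X in (_ <= X)%N]card_ord max_card.
  have : 0 <= (des_count (sample_key x))%:R :> R by [].
  have : 0 <= n%:R :> R by [].
  by rewrite ler_norml; lra.
rewrite -[leRHS]mulrA ler_wpM2l ?mulr_ge0 ?exprn_ge0 //.
rewrite ler_pdivrMr ?ltr0n // mulrAC ler_pdivlMr ?ltr0n // -!natrM ler_nat.
by apply: leq_trans ng; rewrite leq_mul2l; apply/orP; right; lia.
Qed.

End Transfer.

(** * Increments of a random word *)

Section Increments.
Variables (n M : nat).
Local Notation V := 'I_(M.*2.+1).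
Local Notation N := (M.*2.+1).
Implicit Types (x y : {ffun 'I_n -> V}).

Definition entry x (t : nat) : V := if t is j.+1 then oapp x 0 (insub j) else 0.

Lemma entryS x (i : 'I_n) : entry x i.+1 = x i.
Proof. by rewrite /= valK. Qed.

Lemma key_at_entry x t : key_at (sample_key x) t = cent (entry x t).
Proof.
case: t => [|t] /=; first by rewrite cent0.
by case: insubP => [i _ _|_] /=; rewrite ?sample_key_spos ?cent0.
Qed.

Definition increments x : {ffun 'I_n -> V} :=
  [ffun i : 'I_n => entry x i.+1 - entry x i].

(** Partial sums from entry 0 recover the word. Being injective on a finite set, [increments] maps
    uniform words to uniform words. *)
Lemma increments_inj : injective increments.
Proof.
move=> x y /ffunP e.
have exy t : (t <= n)%N -> entry x t = entry y t.
  elim: t => // t IH tn; have := e (Ordinal tn); rewrite !ffunE.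
  rewrite [entry x (Ordinal tn)]IH 1?ltnW // => /addIr.
  by [].
by apply/ffunP => i; rewrite -!entryS exy.
Qed.

Lemma sum_increments x :
  \sum_i (nat_of_ord (increments x i))%:Z =
  cent (entry x n) + N%:Z * (des_count (sample_key x))%:Z.
Proof.
pose F t := cent (entry x t).
transitivity (\sum_(i < n) ((F i.+1 - F i) + N%:Z * (F i.+1 < F i)%R%:Z)).
  by apply: eq_bigr => i _; rewrite ffunE val_centB.
rewrite big_split /=; congr (_ + _).
  rewrite -(big_mkord xpredT (fun i => F i.+1 - F i)) telescope_sumr //.
  by rewrite /F /= cent0 subr0.
rewrite -mulr_sumr; congr (_ * _).
rewrite /des_count -sum1dep_card [in RHS]big_mkcond (big_morph Posz PoszD erefl).
by apply: eq_bigr => i _; rewrite /F !key_at_entry; case: (_ < _)%R.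
Qed.

Variable R : realType.

(** An increment centered at its mean [M] and scaled by [N]. *)
Definition step_value (u : V) : R := (u%:R - M%:R) / N%:R.

(** Centering the n increments subtracts n M / N = n/2 - n/(2N); the defect n/(2N) and the last
    letter form this remainder. *)
Definition drift x : R := (n%:R / 2 + (cent (entry x n))%:~R) / N%:R.

Lemma des_count_increments x :
  (des_count (sample_key x))%:R - n%:R / 2 =
  \sum_i step_value (increments x i) - drift x.
Proof.
have := congr1 (fun z : int => z%:~R : R) (sum_increments x).
rewrite rmorph_sum rmorphD rmorphM /=.
have -> : \sum_i step_value (increments x i) =
    (\sum_i (nat_of_ord (increments x i))%:~R - n%:R * M%:R) / N%:R.
  by rewrite -mulr_suml big_split /= sumr_const card_ord -[X in _ + X]mulr_natl mulrN.
move=> ->; rewrite /drift -!pmulrn.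
have : N%:R != 0 :> R by [].
have -> : N%:R = 2 * M%:R + 1 :> R by rewrite -natr1 -mul2n natrM.
by move=> h; field.
Qed.

Lemma drift_le1 x : (n <= N)%N -> `|drift x| <= 1.
Proof.
move=> nN; rewrite /drift normrM (ger0_norm (x := N%:R^-1)) ?invr_ge0 // ler_pdivrMr // mul1r.
have : `|(cent (entry x n))%:~R| <= M%:R :> R.
  by rewrite -intr_norm -[M%:R]/(M%:Z%:~R) ler_int cent_bound.
have -> : N%:R = 2 * M%:R + 1 :> R by rewrite -natr1 -mul2n natrM.
have : n%:R <= 2 * M%:R + 1 :> R by rewrite -natrM natr1 ler_nat mul2n.
have : 0 <= n%:R :> R by [].
by rewrite !ler_norml; lra.
Qed.

Lemma step_value_le1 u : `|step_value u| <= 1.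
Proof.
rewrite /step_value normrM (ger0_norm (x := N%:R^-1)) ?invr_ge0 // ler_pdivrMr // mul1r.
have : u%:R <= N%:R :> R by rewrite ler_nat ltnW.
have -> : N%:R = 2 * M%:R + 1 :> R by rewrite -natr1 -mul2n natrM.
have : 0 <= M%:R :> R by [].
have : 0 <= u%:R :> R by [].
by rewrite ler_norml; lra.
Qed.

Lemma avg_increments (f : {ffun 'I_n -> V} -> R) :
  avg [set: {ffun 'I_n -> V}] (f \o increments) = avg [set: {ffun 'I_n -> V}] f.
Proof.
rewrite /avg [in RHS](reindex_inj increments_inj) /=; congr (_ / _).
by apply: eq_bigl => x; rewrite !inE.
Qed.

Definition step_moment j : R := (\sum_u step_value u ^+ j) / N%:R.

Lemma step_moment0 : step_moment 0 = 1.
Proof.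
rewrite /step_moment (eq_bigr (fun=> 1)) => [|u _]; last by rewrite expr0.
by rewrite sumr_const card_ord mulfV.
Qed.

Lemma step_moment_le1 j : `|step_moment j| <= 1.
Proof.
rewrite /step_moment normrM (ger0_norm (x := N%:R^-1)) ?invr_ge0 // ler_pdivrMr // mul1r.
rewrite (le_trans (ler_norm_sum _ _ _)) // -[X in _ <= X%:R](card_ord N) -sumr_const.
by apply: ler_sum => u _; rewrite normrX exprn_ile1 ?step_value_le1.
Qed.

Lemma sum_shift (c : R) K : \sum_(u < K) (u%:R - c) = K%:R * (K%:R - 1) / 2 - c * K%:R.
Proof.
elim: K => [|K IH]; first by rewrite big_ord0; field.
by rewrite big_ord_recr /= IH -natr1; field.
Qed.

Lemma sum_shift_sqr (c : R) K : \sum_(u < K) (u%:R - c) ^+ 2 =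
  c ^+ 2 * K%:R - c * K%:R * (K%:R - 1) + (K%:R - 1) * K%:R * (2 * K%:R - 1) / 6.
Proof.
elim: K => [|K IH]; first by rewrite big_ord0; field.
by rewrite big_ord_recr /= IH -natr1; field.
Qed.

Lemma step_moment1 : step_moment 1 = 0.
Proof.
rewrite /step_moment (eq_bigr (fun u : V => (u%:R - M%:R) / N%:R)) //.
have -> : N%:R = 2 * M%:R + 1 :> R by rewrite -natr1 -mul2n natrM.
rewrite -mulr_suml sum_shift.
have -> : N%:R = 2 * M%:R + 1 :> R by rewrite -natr1 -mul2n natrM.
by apply/eqP; rewrite !mulf_eq0; apply/orP; left; apply/orP; left; apply/eqP; field.
Qed.

Lemma step_moment2 : step_moment 2 = (N%:R ^+ 2 - 1) / (12 * N%:R ^+ 2).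
Proof.
rewrite /step_moment (eq_bigr (fun u : V => (u%:R - M%:R) ^+ 2 / N%:R ^+ 2)); last first.
  by move=> u _; rewrite /step_value exprMn exprVn.
rewrite -mulr_suml sum_shift_sqr.
have N0 : N%:R != 0 :> R by [].
have -> : M%:R = (N%:R - 1) / 2 :> R.
  by rewrite -natr1 -mul2n natrM; field.
by field.
Qed.

Definition expo m (a : R) : {poly R} := \poly_(j < m.+1) (a ^+ j / j`!%:R).

(** The exponential turns sums into products, and truncation at degree [m] leaves the coefficients
    up to [m] intact. *)
Lemma coef_prod_expo m k (a : 'I_n -> R) : (k <= m)%N ->
  (\prod_i expo m (a i))`_k = (\sum_i a i) ^+ k / k`!%:R.
Proof.
suff: forall k, (k <= m)%N -> (\prod_i expo m (a i))`_k = (\sum_i a i) ^+ k / k`!%:R by apply.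
elim/big_rec2: _ => [|i s P _ IH] {}k km.
  by rewrite coef1; case: k km => [|k] _; rewrite ?expr0 ?divr1 // expr0n mul0r.
rewrite coefM exprDn mulr_suml (reindex_inj rev_ord_inj) /=; apply: eq_bigr => j _.
have jk : (j <= k)%N by rewrite -ltnS.
rewrite subSS subKn // coef_poly ltnS (leq_trans (leq_subr _ _)) // IH ?(leq_trans jk) //.
rewrite -(bin_fact jk) !natrM -mulr_natr.
have f1 : j`!%:R != 0 :> R by rewrite pnatr_eq0 -lt0n fact_gt0.
have f2 : (k - j)`!%:R != 0 :> R by rewrite pnatr_eq0 -lt0n fact_gt0.
have f3 : 'C(k, j)%:R != 0 :> R by rewrite pnatr_eq0 -lt0n bin_gt0.
by move: f1 f2 f3; move: (_ ^+ (k - j)) (s ^+ j) => p q; set c := 'C(k, j)%:R;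
   set d := _`!%:R; set e := _`!%:R; move=> *; field; repeat (apply/andP; split).
Qed.

(** The truncated moment generating function of one step. *)
Definition step_poly m : {poly R} := \poly_(j < m.+1) (step_moment j / j`!%:R).

(** By independence the generating function of the sum is the n-th power of that of one step. *)
Lemma avg_sum_step_pow m k : (k <= m)%N ->
  avg [set: {ffun 'I_n -> V}] (fun y => (\sum_i step_value (y i)) ^+ k) =
  k`!%:R * (step_poly m ^+ n)`_k.
Proof.
move=> km.
have -> : step_poly m = (N%:R)^-1 *: \sum_(u : V) expo m (step_value u).
  apply/polyP => j; rewrite coefZ coef_sum coef_poly.
  case: ltnP => jm.
    rewrite /step_moment mulrAC mulrC; congr (_ * _); rewrite mulr_suml.
    by apply: eq_bigr => u _; rewrite coef_poly jm.
  by rewrite big1 ?mulr0 // => u _; rewrite coef_poly ltnNge jm.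
rewrite exprZn coefZ.
have -> : (\sum_(u : V) expo m (step_value u)) ^+ n =
    \sum_(y : {ffun 'I_n -> V}) \prod_i expo m (step_value (y i)).
  by rewrite -(bigA_distr_bigA (fun i u => expo m (step_value u))) /= prodr_const card_ord.
rewrite coef_sum (eq_bigr (fun y : {ffun 'I_n -> V} => (\sum_i step_value (y i)) ^+ k / k`!%:R)); last first.
  by move=> y _; rewrite coef_prod_expo.
rewrite -mulr_suml /avg cardsT card_ffun !card_ord natrX exprVn.
have f1 : k`!%:R != 0 :> R by rewrite pnatr_eq0 -lt0n fact_gt0.
rewrite (eq_bigl xpredT) => [|y]; last by rewrite inE.
have N0 : N%:R ^+ n != 0 :> R by rewrite expf_neq0.
by move: (\sum_(y | _) _) N0; move: (N%:R ^+ n) => a b a0; field; apply/andP; split.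
Qed.

End Increments.

Lemma eq_oppr0 (R : realType) (a : R) : a = - a -> a = 0.
Proof. by move=> e; lra. Qed.

(** * Marginals and symmetries of a uniform word *)

Section Marginals.
Variables (n M : nat) (R : realType).
Local Notation V := 'I_(M.*2.+1).
Local Notation N := (M.*2.+1).
Local Notation Omega := [set: {ffun 'I_n -> V}].
Local Notation v := (@step_value M R).

Lemma sum_marginal (f : V -> R) (i : 'I_n) :
  avg Omega (fun x => f (x i)) = (\sum_u f u) / N%:R.
Proof.
(* With factors 1 off [i], the sum over words becomes a product over positions. *)
pose F j u := if j == i then f u else 1.
rewrite /avg (eq_bigl xpredT) => [|x]; last by rewrite inE.
rewrite (eq_bigr (fun x : {ffun 'I_n -> V} => \prod_j F j (x j))) => [|x _]; last first.
  rewrite (bigD1 i) //= {1}/F eqxx big1 ?mulr1 // => j ji.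
  by rewrite /F (negPf ji).
rewrite -(bigA_distr_bigA F) /= (bigD1 i) //= {1}/F eqxx.
have -> : \prod_(j < n | j != i) \sum_u F j u = \prod_(j < n | j != i) N%:R.
  apply: eq_bigr => j /negPf ji; rewrite (eq_bigr (fun=> 1)) ?sumr_const ?card_ord // => u _.
  by rewrite /F ji.
rewrite prodr_const cardsT card_ffun !card_ord cardC1 card_ord.
have n0 : (0 < n)%N by apply: leq_ltn_trans (ltn_ord i).
have -> : (N ^ n)%:R = N%:R ^+ n.-1 * N%:R :> R by rewrite natrX -exprSr prednK.
have P0 : N%:R ^+ n.-1 != 0 :> R by rewrite expf_neq0.
by rewrite [_ * N%:R]mulrC -mulf_div mulfV // mulr1.
Qed.

Lemma entry_opp (x : {ffun 'I_n -> V}) t : entry (- x) t = - entry x t.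
Proof.
by case: t => [|t] /=; rewrite ?oppr0 //; case: insub => [i|] /=; rewrite ?ffunE ?oppr0.
Qed.

(** Negating the whole word is a symmetry that changes the sign. *)
Lemma avg_cent_entry t :
  avg Omega (fun x => (cent (entry x t))%:~R : R) = 0.
Proof.
apply: eq_oppr0; rewrite {1}/avg (reindex_inj (@oppr_inj {ffun 'I_n -> V})) /= /avg -mulNr -sumrN.
congr (_ / _); apply: eq_big => x; first by rewrite !inE.
by rewrite entry_opp centN rmorphN.
Qed.

Lemma cent_rotate (u : V) : cent u = (nat_of_ord (u + inord M))%:Z - M%:Z.
Proof.
have := ltn_ord u; rewrite /cent /= inordK; last by lia.
case: (leqP u M) => uM uN; first by rewrite modn_small; lia.
have -> : (u + M = u + M - N + N)%N by lia.
by rewrite modnDr modn_small; lia.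
Qed.

Lemma avg_cent_entry_sqr : (0 < n)%N ->
  avg Omega (fun x => (cent (entry x n))%:~R ^+ 2 : R) = N%:R ^+ 2 * step_moment M R 2.
Proof.
move=> n0; have N0 : N%:R != 0 :> R by [].
pose i := Ordinal (etrans (ltn_predL n) n0).
rewrite (_ : (fun x => _) = (fun x : {ffun 'I_n -> V} => (fun u => (cent u)%:~R ^+ 2) (x i))); last first.
  by apply/funext => x; rewrite -entryS (_ : i.+1 = n :> nat) //= prednK.
rewrite (sum_marginal (fun u => (cent u)%:~R ^+ 2) i) /step_moment mulrA; congr (_ / _).
rewrite mulr_sumr [RHS](reindex_inj (addIr (inord M : V))) /=; apply: eq_bigr => u _.
rewrite /step_value cent_rotate rmorphB /= -!pmulrn -exprMn; congr (_ ^+ 2).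
by rewrite mulrC divfK.
Qed.

Lemma entry_sum (x : {ffun 'I_n -> V}) : entry x n = \sum_i increments x i.
Proof.
under eq_bigr do rewrite ffunE.
by rewrite -(big_mkord xpredT (fun i => entry x i.+1 - entry x i)) telescope_sumr // subr0.
Qed.

(** For each step y_i there is another index j, and changing y_j alone can reverse the sign of the
    last letter while y_i is kept. *)
Lemma avg_step_cent : (1 < n)%N ->
  avg Omega (fun x => (\sum_i v (increments x i)) * (cent (entry x n))%:~R) = 0.
Proof.
move=> n1.
rewrite (_ : (fun x => _) = (fun y : {ffun 'I_n -> V} =>
    \sum_i v (y i) * (cent (\sum_j y j))%:~R) \o @increments n M); last first.
  by apply/funext => x /=; rewrite mulr_suml -entry_sum.
rewrite avg_increments /avg exchange_big /= big1 ?mul0r // => i _.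
have [j ji] : exists j : 'I_n, j != i.
  apply/existsP; apply: contraTT n1; rewrite negb_exists -leqNgt => /forallP h.
  rewrite -[n]card_ord -(cardsT 'I_n) -(cards1 i); apply/subset_leq_card/fintype.subsetP => j _.
  by rewrite inE; have := h j; rewrite negbK.
pose s (y : {ffun 'I_n -> V}) := \sum_l y l.
(* Subtracting 2 s from letter j sends the sum s to -s; doing it twice restores the word. *)
pose flip (y : {ffun 'I_n -> V}) : {ffun 'I_n -> V} := [ffun l => if l == j then y l - s y - s y else y l].
have sflip y : s (flip y) = - s y.
  have cancel (a b c : V) : a + b = c -> a - c - c + b = - c.
    by move=> <-; rewrite addrAC (addrAC a) subrr sub0r.
  rewrite {1}/s (bigD1 j) //= ffunE eqxx (eq_bigr y) => [|l /negPf lj]; last by rewrite ffunE lj.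
  by apply: cancel; rewrite /s [RHS](bigD1 j).
have flipK : involutive flip.
  move=> y; apply/ffunP => l; rewrite ffunE sflip !opprK.
  by case: ifP => lj; rewrite ffunE lj // !subrK.
set S := \sum_(y in _) _; apply: eq_oppr0.
rewrite {1}/S (reindex_inj (inv_inj flipK)) /= /S -sumrN.
apply: eq_big => y; rewrite ?inE // => _.
by rewrite -[\sum_l flip y l]/(s (flip y)) sflip centN ffunE eq_sym (negPf ji) rmorphN mulrN.
Qed.

End Marginals.

(** * Asymptotics of the moments *)

Lemma sum_ord_support (R : nmodType) (F : nat -> R) a b :
  (forall i, (a <= i)%N -> F i = 0) -> (a <= b)%N -> \sum_(i < b) F i = \sum_(i < a) F i.
Proof.
move=> F0 ab; rewrite -!(big_mkord xpredT F) (big_cat_nat _ ab) //=.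
by rewrite [X in _ + X]big_nat_cond [X in _ + X]big1 ?addr0 // => i /andP[/andP[/F0]].
Qed.

(** Binomial expansion; only i with 2i <= k matter, so the number of terms does not depend on
    [n]. *)
Lemma coef_expr_1DX2 (R : comNzRingType) (p : {poly R}) n k :
  ((1 + 'X^2 * p) ^+ n)`_k =
  \sum_(i < k.+1) 'C(n, i)%:R * (if (2 * i <= k)%N then (p ^+ i)`_(k - 2 * i) else 0).
Proof.
pose F i := 'C(n, i)%:R * (if (2 * i <= k)%N then (p ^+ i)`_(k - 2 * i) else 0).
have F0n i : (n.+1 <= i)%N -> F i = 0 by move=> ni; rewrite /F bin_small // mul0r.
have F0k i : (k.+1 <= i)%N -> F i = 0.
  by move=> ki; rewrite /F ifF ?mulr0 //; apply/negbTE; lia.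
transitivity (\sum_(i < n.+1) F i).
  rewrite addrC exprD1n coef_sum; apply: eq_bigr => i _.
  by rewrite coefMn -[LHS]mulr_natl /F exprMn -exprM coefXnM; case: leqP.
rewrite -(sum_ord_support F0n (leq_addr k n.+1)).
by rewrite (_ : (n.+1 + k = k.+1 + n)%N) ?(sum_ord_support F0k) ?leq_addr //; lia.
Qed.

Lemma coef_expr_bound (R : realType) (p : {poly R}) i j :
  (forall l, `|p`_l| <= 1) -> `|(p ^+ i)`_j| <= (j.+1%:R) ^+ i.
Proof.
move=> p1; elim: i j => [|i IH] j.
  by rewrite !expr0 coef1; case: eqP => _; rewrite ?normr1 ?normr0.
rewrite exprS coefM (le_trans (ler_norm_sum _ _ _)) //.
apply: (@le_trans _ _ (\sum_(l < j.+1) (j.+1%:R) ^+ i)); last first.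
  by rewrite sumr_const card_ord -[leLHS]mulr_natl -exprS.
apply: ler_sum => l _; rewrite normrM -[leRHS]mul1r ler_pM //.
by rewrite (le_trans (IH _)) // lerXn2r ?nnegrE // ler_nat ltnS leq_subr.
Qed.

Section StepPoly.
Variables (R : realType) (M m : nat).

(** Steps have mean 0, so the generating function is 1 plus ['X^2] times this tail. *)
Definition step_tail : {poly R} :=
  \poly_(j < m.-1) (step_moment M R j.+2 / (j.+2)`!%:R).

Lemma step_polyE : step_poly M R m = 1 + 'X^2 * step_tail.
Proof.
apply/polyP => j; rewrite coefD coef1 coefXnM !coef_poly.
case: j => [|[|j]] /=.
- by rewrite step_moment0 divr1 addr0.
- by rewrite step_moment1 mul0r addr0; case: ifP.
- rewrite add0r subn2 /=; case: m => [|m'] //=.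
Qed.

Lemma step_tail_le1 l : `|step_tail`_l| <= 1.
Proof.
rewrite coef_poly; case: ifP => _; rewrite ?normr0 // normrM.
rewrite [X in _ * X]ger0_norm ?invr_ge0 // ler_pdivrMr ?ltr0n ?fact_gt0 // mul1r.
by rewrite (le_trans (step_moment_le1 _ _ _)) // ler1n fact_gt0.
Qed.

Lemma step_tail0 : (1 < m)%N -> step_tail`_0 = step_moment M R 2 / 2.
Proof. by move=> m1; rewrite coef_poly ifT //; lia. Qed.

End StepPoly.

Lemma avg_sum_step1 (R : realType) n M :
  avg [set: {ffun 'I_n -> 'I_(M.*2.+1)}] (fun y => \sum_i @step_value M R (y i)) = 0.
Proof.
have -> : (fun y : {ffun 'I_n -> 'I_(M.*2.+1)} => \sum_i step_value R (y i)) =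
    (fun y => (\sum_i step_value R (y i)) ^+ 1) by apply/funext => y; rewrite expr1.
rewrite (avg_sum_step_pow n M R (leqnn 1)) step_polyE coef_expr_1DX2 !big_ord_recl big_ord0 /=.
by rewrite expr0 coef1 !mulr0 !addr0 mulr0.
Qed.

Lemma avg_sum_step2 (R : realType) n M :
  avg [set: {ffun 'I_n -> 'I_(M.*2.+1)}] (fun y => (\sum_i @step_value M R (y i)) ^+ 2) =
  n%:R * step_moment M R 2.
Proof.
rewrite (avg_sum_step_pow n M R (leqnn 2)) step_polyE coef_expr_1DX2 !big_ord_recl big_ord0 /=.
rewrite expr0 coef1 expr1 step_tail0 // /= !mulr0 !addr0 add0r bin1.
by rewrite mulrCA; congr (_ * _); rewrite (_ : 2`! = 2)%N // mulrC divfK.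
Qed.

(** * Exact first and second moments of the descent number of a word *)

Section ModelMoments.
Variables (R : realType) (n M : nat).
Hypothesis n1 : (1 < n)%N.
Local Notation V := 'I_(M.*2.+1).
Local Notation N := (M.*2.+1).
Local Notation Omega := [set: {ffun 'I_n -> V}].

Let Omega_gt0 : (0 < #|Omega|)%N.
Proof. by rewrite cardsT card_ffun !card_ord expn_gt0. Qed.

Let avg_step1 : avg Omega (fun x => \sum_i @step_value M R (increments x i)) = 0.
Proof.
apply: etrans (avg_sum_step1 R n M).
exact: (avg_increments (fun y => \sum_i @step_value M R (y i))).
Qed.

Lemma avg_model1 :
  avg Omega (fun x => (des_count (sample_key x))%:R - n%:R / 2 : R) = - (n%:R / 2 / N%:R).
Proof.
rewrite (_ : (fun x => _) = (fun x => \sum_i step_value R (increments x i) +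
   (- (n%:R / 2 / N%:R) + (- N%:R^-1) * (cent (entry x n))%:~R))); last first.
  by apply/funext => x; rewrite des_count_increments /drift; ring.
by rewrite avgD avgD avgZ avg_cent_entry avg_step1 avg_cst // mulr0 addr0 add0r.
Qed.

(** The steps contribute n times the step variance, the last letter in the drift contributes one
    more, and their cross term vanishes: hence n + 1. The other summand is the squared bias. *)
Lemma avg_model2 :
  avg Omega (fun x => ((des_count (sample_key x))%:R - n%:R / 2) ^+ 2 : R) =
  n.+1%:R * step_moment M R 2 + (n%:R / 2 / N%:R) ^+ 2.
Proof.
pose A (x : {ffun 'I_n -> V}) := \sum_i step_value R (increments x i).
pose c (x : {ffun 'I_n -> V}) : R := (cent (entry x n))%:~R.
set a := n%:R / 2 / N%:R.
rewrite (_ : (fun x => _) = (fun x => A x ^+ 2 + ((- 2 * a) * A x + ((- 2 / N%:R) * (A x * c x) +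
   (a ^+ 2 + ((2 * a / N%:R) * c x + N%:R ^- 2 * (c x ^+ 2))))))); last first.
  apply/funext => x; rewrite des_count_increments /drift /a -/(A x) -/(c x).
  have N0 : N%:R != 0 :> R by [].
  by move: (A x) (c x) N0 => p q; move: N%:R => r r0; field.
rewrite !avgD !avgZ avg_step1 avg_step_cent // avg_cst // avg_cent_entry.
rewrite avg_cent_entry_sqr; last exact: ltnW.
have -> : avg Omega (fun x => A x ^+ 2) = n%:R * step_moment M R 2.
  by rewrite -avg_sum_step2 -[RHS]avg_increments.
have N0 : N%:R != 0 :> R by [].
rewrite !mulr0 !add0r -[n.+1%:R]natr1 -/a mulKf ?expf_neq0 //.
by move: a => a; ring.
Qed.

End ModelMoments.

Local Open Scope classical_set_scope.

Section Limits.
Variable R : realType.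
Implicit Types (u v : nat -> R).

Lemma cvg0_dominated u v : (\forall n \near \oo, `|u n| <= v n) ->
  v n @[n --> \oo] --> (0 : R) -> u n @[n --> \oo] --> (0 : R).
Proof.
move=> uv v0; apply/norm_cvg0P; apply: squeeze_cvgr (cvg_cst _) v0.
by near do rewrite normr_ge0 /=.
Unshelve. all: by end_near. Qed.

Lemma cvg_sum_ord K (F : 'I_K -> nat -> R) (l : 'I_K -> R) :
  (forall i, F i n @[n --> \oo] --> l i) ->
  (\sum_i F i n) @[n --> \oo] --> \sum_i l i.
Proof.
move=> Fl; elim: (index_enum _) => [|i s IH].
  rewrite big_nil (_ : (fun _ => _) = (fun=> 0)); first exact: cvg_cst.
  by apply/funext => n; rewrite big_nil.
rewrite big_cons (_ : (fun _ => _) = (fun n => F i n + \sum_(j <- s) F j n)).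
  exact: cvgD.
by apply/funext => n; rewrite big_cons.
Qed.

Definition des_scale (n : nat) : R := Num.sqrt (n.+1%:R / 12).

Lemma des_scale_sqr n : des_scale n ^+ 2 = n.+1%:R / 12.
Proof. by rewrite sqr_sqrtr. Qed.

Lemma des_scale_gt0 n : 0 < des_scale n.
Proof. by rewrite sqrtr_gt0 divr_gt0. Qed.

Lemma des_scale_ge1 n : (11 <= n)%N -> 1 <= des_scale n.
Proof.
move=> n11; rewrite -(@ler_pXn2r _ 2) ?nnegrE ?(ltW (des_scale_gt0 n)) //.
by rewrite des_scale_sqr expr1n ler_pdivlMr // mul1r ler_nat.
Qed.

Lemma des_scaleV_cvg0 : (des_scale n)^-1 @[n --> \oo] --> (0 : R).
Proof.
rewrite (_ : (fun _ => _) = (fun n => Num.sqrt (12 * @harmonic R n))); last first.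
  by apply/funext => n; rewrite /des_scale -sqrtrV // invf_div.
rewrite -[X in _ --> X](sqrtr0 R); apply: continuous_cvg; first exact: sqrt_continuous.
rewrite -[X in _ --> X](mulr0 12); apply: cvgM; first exact: cvg_cst.
exact: cvg_harmonic.
Qed.

Variable (M : nat -> nat).
Hypothesis nM : forall n, (n <= M n)%N.

Lemma step_moment2_cvg : step_moment (M n) R 2 @[n --> \oo] --> (12^-1 : R).
Proof.
have -> : (fun n => step_moment (M n) R 2) =
    (fun n => 12^-1 - 12^-1 * (((M n).*2.+1)%:R ^- 2)).
  by apply/funext => n; rewrite step_moment2; field.
rewrite -[X in _ --> X]subr0; apply: cvgB; first exact: cvg_cst.
rewrite -[X in _ --> X](mulr0 12^-1); apply: cvgM; first exact: cvg_cst.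
apply: cvg0_dominated (@cvg_harmonic R); near=> n.
rewrite ger0_norm ?invr_ge0 ?exprn_ge0 // lef_pV2 ?posrE ?exprn_gt0 //.
by rewrite -natrX ler_nat; have := nM n; nia.
Unshelve. all: by end_near. Qed.

(** The coefficient of x^k in exp(x^2 / 2). *)
Definition gauss_coef (k : nat) : R := if odd k then 0 else 2^-1 ^+ k./2 / (k./2)`!%:R.

Lemma leq_bin_expn n i : ('C(n, i) <= n ^ i)%N.
Proof.
elim: i => [|i IH]; first by rewrite bin0.
rewrite -(leq_pmul2l (ltn0Sn i)) mul_bin_left expnS mulnA leq_mul //.
by rewrite (leq_trans (leq_subr _ _)) // leq_pmull.
Qed.

(** The limit 1/24 is half the limiting step variance 1/12. Induction on [i] through the ratio of
    consecutive terms. *)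
Lemma cvg_bin_term (p : nat -> R) i : p n @[n --> \oo] --> (24^-1 : R) ->
  ('C(n, i)%:R * p n ^+ i / des_scale n ^+ (2 * i)) @[n --> \oo] -->
  (2^-1 ^+ i / i`!%:R : R).
Proof.
move=> pl; elim: i => [|i IH].
  rewrite (_ : (fun _ => _) = (fun=> 1)); last first.
    by apply/funext => n; rewrite bin0 !expr0 !mul1r invr1.
  by rewrite expr0 mul1r invr1; exact: cvg_cst.
pose q n : R := (n - i)%:R / des_scale n ^+ 2 * p n / i.+1%:R.
rewrite (_ : (fun _ => _) = (fun n => 'C(n, i)%:R * p n ^+ i / des_scale n ^+ (2 * i) * q n)); last first.
  apply/funext => n; rewrite /q.
  have e : i.+1%:R * 'C(n, i.+1)%:R = (n - i)%:R * 'C(n, i)%:R :> R.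
    by rewrite -!natrM mul_bin_left.
  have -> : 'C(n, i.+1)%:R = (n - i)%:R * 'C(n, i)%:R / i.+1%:R :> R.
    by rewrite -e mulrC mulKf.
  have s0 : des_scale n != 0 by rewrite gt_eqF ?des_scale_gt0.
  rewrite mulnS addnC exprD exprS.
  have s1 : des_scale n ^+ (2 * i) != 0 by rewrite expf_neq0.
  have i1 : i.+1%:R != 0 :> R by [].
  move: i1 s0 s1; move: (i.+1%:R) (des_scale n ^+ (2 * i)) => a b a0 s0 b0.
  by field; rewrite ?a0 ?b0 ?s0.
have -> : 2^-1 ^+ i.+1 / (i.+1)`!%:R = 2^-1 ^+ i / i`!%:R * (12 * 24^-1 / i.+1%:R) :> R.
  rewrite factS natrM exprS.
  have f0 : i`!%:R != 0 :> R by rewrite pnatr_eq0 -lt0n fact_gt0.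
  have i1 : i.+1%:R != 0 :> R by [].
  by move: i1 f0; move: (i.+1%:R) (i`!%:R) => a b a0 b0; field; rewrite a0 b0.
apply: cvgM => //; apply: cvgM; last exact: cvg_cst.
apply: cvgM => //.
(* For i <= n, 12 (n - i) / (n + 1) = 12 - 12 (i + 1) / (n + 1). *)
rewrite (_ : 12 = 12 - 12 * i.+1%:R * 0); last by rewrite mulr0 subr0.
have h : (12 - 12 * i.+1%:R * @harmonic R n) @[n --> \oo] --> (12 - 12 * i.+1%:R * 0 : R).
  apply: cvgB; first exact: cvg_cst.
  by apply: cvgM; [exact: cvg_cst | exact: cvg_harmonic].
apply: cvg_trans h; apply: near_eq_cvg; near=> n.
have ni : (i <= n)%N by near: n; exact: nbhs_infty_ge.
rewrite des_scale_sqr natrB // /harmonic /=.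
have n1 : n.+1%:R != 0 :> R by [].
rewrite -[i.+1%:R]natr1; have -> : n%:R = n.+1%:R - 1 :> R by rewrite -natr1 addrK.
by field.
Unshelve. all: by end_near. Qed.

(** Term i of the expansion has order at most n^i against n^(k/2), so only 2i = k survives in the
    limit. *)
Lemma step_poly_cvg m k : (1 < m)%N ->
  ((step_poly (M n) R m ^+ n)`_k / des_scale n ^+ k) @[n --> \oo] --> gauss_coef k.
Proof.
move=> m1.
pose F (i : 'I_k.+1) n : R := 'C(n, i)%:R *
  (if (2 * i <= k)%N then (step_tail R (M n) m ^+ i)`_(k - 2 * i) else 0) / des_scale n ^+ k.
pose l (i : 'I_k.+1) : R := if (2 * i == k)%N then 2^-1 ^+ i / i`!%:R else 0.
rewrite (_ : (fun _ => _) = (fun n => \sum_i F i n)); last first.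
  by apply/funext => n; rewrite step_polyE coef_expr_1DX2 mulr_suml.
have -> : gauss_coef k = \sum_i l i.
  rewrite /gauss_coef; have [ko|ke] := boolP (odd k).
    by rewrite big1 // => i _; rewrite /l; case: eqP => // e; rewrite -e oddM in ko.
  have k2 : (k./2 < k.+1)%N by rewrite ltnS -{2}(odd_double_half k) -addnn addnA leq_addl.
  have kk : (2 * k./2 = k)%N by rewrite mul2n even_halfK.
  rewrite (bigD1 (Ordinal k2)) //= big1 ?addr0 /l /= ?kk ?eqxx // => i /eqP ne.
  by case: eqP => // e; case: ne; apply: val_inj => /=; lia.
apply: cvg_sum_ord => i; rewrite /F /l.
case: (ltngtP (2 * i) k) => [ik|ki|e].
(* With s the scale, n^i <= 12^i s^(2i) <= 12^i s^(k-1), which leaves a factor 1/s. *)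
- apply: (@cvg0_dominated _ (fun n => (12 ^+ i * (k - 2 * i).+1%:R ^+ i) * (des_scale n)^-1)); last first.
    rewrite -[X in _ --> X](mulr0 (12 ^+ i * (k - 2 * i).+1%:R ^+ i)); apply: cvgM; first exact: cvg_cst.
    exact: des_scaleV_cvg0.
  near=> n.
  have s1 : 1 <= des_scale n by apply: des_scale_ge1; near: n; exact: nbhs_infty_ge.
  have s0 := des_scale_gt0 n.
  rewrite !normrM [`|(_ ^+ k)^-1|]ger0_norm ?invr_ge0 ?exprn_ge0 ?(ltW s0) //.
  rewrite ler_pdivrMr ?exprn_gt0 // ger0_norm //.
  apply: (@le_trans _ _ (n%:R ^+ i * (k - 2 * i).+1%:R ^+ i)).
    rewrite ler_pM // ?coef_expr_bound //; first last.
      by move=> l'; exact: step_tail_le1.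
    by rewrite -natrX ler_nat leq_bin_expn.
  have h : n%:R ^+ i <= 12 ^+ i * (des_scale n)^-1 * des_scale n ^+ k.
    have -> : 12 ^+ i * (des_scale n)^-1 * des_scale n ^+ k = 12 ^+ i * des_scale n ^+ k.-1.
      have e : des_scale n ^+ k = des_scale n * des_scale n ^+ k.-1.
        by rewrite -exprS (ltn_predK ik).
      by rewrite e -mulrA mulKf // gt_eqF.
    apply: (@le_trans _ _ ((12 * des_scale n ^+ 2) ^+ i)).
      rewrite lerXn2r ?nnegrE // des_scale_sqr.
        by rewrite mulr_ge0 ?divr_ge0.
      by rewrite mulrCA mulfV // mulr1 ler_nat.
    rewrite exprMn -exprM ler_wpM2l ?exprn_ge0 // ler_weXn2l //; lia.
  apply: le_trans (ler_wpM2r _ h) _; first by rewrite exprn_ge0.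
  by rewrite le_eqVlt; apply/orP; left; apply/eqP; ring.
- rewrite (_ : (fun _ => _) = (fun=> 0)); first exact: cvg_cst.
  by apply/funext => n; rewrite mulr0 mul0r.
- rewrite (_ : (fun _ => _) = (fun n => 'C(n, i)%:R * (step_moment (M n) R 2 / 2) ^+ i / des_scale n ^+ (2 * i))); last first.
    apply/funext => n; rewrite e subnn -(step_tail0 _ _ m1); congr (_ * _ / _).
    by elim: (nat_of_ord i) => [|j IH]; rewrite ?expr0 ?coef1 // !exprS coef0M IH.
  apply: cvg_bin_term; have -> : 24^-1 = 12^-1 / 2 :> R by field.
  by apply: cvgM; [exact: step_moment2_cvg | exact: cvg_cst].
Unshelve. all: by end_near. Qed.

End Limits.

(** * Limits of the normalized moments on words and on conjugacy classes *)

Lemma expr_shift_bound (R : realType) (z d : R) k : `|d| <= 1 ->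
  `|(z - d) ^+ k - z ^+ k| <= `|d| * (k%:R * (`|z| + 1) ^+ k).
Proof.
move=> d1; elim: k => [|k IH]; first by rewrite !expr0 subrr normr0 mul0r mulr0.
have -> : (z - d) ^+ k.+1 - z ^+ k.+1 = (z - d) * ((z - d) ^+ k - z ^+ k) - d * z ^+ k.
  by rewrite !exprS; ring.
have z0 : 0 <= `|z| by [].
have zd : `|z - d| <= `|z| + 1 by rewrite (le_trans (ler_normB _ _)) // lerD2l.
apply: le_trans (ler_normB _ _) _; rewrite !normrM normrX.
apply: (@le_trans _ _ ((`|z| + 1) * (`|d| * (k%:R * (`|z| + 1) ^+ k)) + `|d| * (`|z| + 1) ^+ k.+1)).
  apply: lerD; first by rewrite ler_pM.
  rewrite ler_wpM2l // exprS -[leLHS]mul1r ler_pM ?exprn_ge0 //; first by lra.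
  by rewrite lerXn2r ?nnegrE //; lra.
by rewrite -natr1 exprS le_eqVlt; apply/orP; left; apply/eqP; ring.
Qed.

(** Replaces an absolute power by an even one, whose averages are known to converge. *)
Lemma expr_norm1_bound (R : realType) (z : R) k :
  (`|z| + 1) ^+ k <= 2 ^+ k * (1 + z ^+ (2 * k)).
Proof.
have z0 : 0 <= `|z| by [].
have e : z ^+ (2 * k) = `|z| ^+ (2 * k) by rewrite -normrX ger0_norm // exprM exprn_ge0 ?sqr_ge0.
have [z1|z1] := leP `|z| 1.
  rewrite -[leLHS]mulr1 ler_pM ?exprn_ge0 ?addr_ge0 //.
    by rewrite lerXn2r ?nnegrE //; lra.
  by rewrite e lerDl exprn_ge0.
apply: (@le_trans _ _ (2 ^+ k * `|z| ^+ k)).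
  by rewrite -exprMn lerXn2r ?nnegrE //; lra.
rewrite ler_wpM2l ?exprn_ge0 // e; apply: le_trans (_ : `|z| ^+ (2 * k) <= _).
  by rewrite ler_weXn2l ?(ltW z1) // leq_pmull.
by rewrite lerDr.
Qed.

Section ModelCvg.
Variables (R : realType) (M : nat -> nat).
Hypothesis nM : forall n, (n <= M n)%N.

Local Notation Omega n := [set: {ffun 'I_n -> 'I_((M n).*2.+1)}]%SET.
Local Notation s n := (des_scale R n).

Lemma avg_sum_step_cvg k :
  avg (Omega n) (fun x => ((\sum_i step_value R (increments x i)) / s n) ^+ k) @[n --> \oo] -->
  (k`!%:R * gauss_coef R k : R).
Proof.
rewrite (_ : (fun _ => _) = (fun n => k`!%:R *
    ((step_poly (M n) R k.+2 ^+ n)`_k / s n ^+ k))); last first.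
  apply/funext => n; rewrite mulrA -avg_sum_step_pow; last by lia.
  rewrite -[in RHS]avg_increments [RHS]mulrC -avgZ; congr avg; apply/funext => x /=.
  by rewrite exprMn exprVn mulrC.
by apply: cvgM; [exact: cvg_cst | exact: step_poly_cvg].
Qed.

(** The drift is at most 1, hence negligible after division by the scale; even moments of the step
    sum control the error. *)
Lemma avg_model_cvg k :
  avg (Omega n) (fun x => (((des_count (sample_key x))%:R - n%:R / 2) / s n) ^+ k) @[n --> \oo] -->
  (k`!%:R * gauss_coef R k : R).
Proof.
pose Z n (x : {ffun 'I_n -> 'I_((M n).*2.+1)}) : R := (\sum_i step_value R (increments x i)) / s n.
pose d n (x : {ffun 'I_n -> 'I_((M n).*2.+1)}) : R := drift R x / s n.
pose D n := avg (Omega n) (fun x => (Z n x - d n x) ^+ k) - avg (Omega n) (fun x => Z n x ^+ k).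
rewrite (_ : (fun _ => _) = (fun n => D n + avg (Omega n) (fun x => Z n x ^+ k))); last first.
  apply/funext => n; rewrite /D subrK; congr avg; apply/funext => x.
  by rewrite des_count_increments mulrBl.
rewrite -[X in _ --> X]add0r; apply: cvgD; last exact: avg_sum_step_cvg.
pose b n : R := (s n)^-1 * (k%:R * (2 ^+ k * (1 + avg (Omega n) (fun x => Z n x ^+ (2 * k))))).
apply: (@cvg0_dominated _ _ b); last first.
  rewrite -[X in _ --> X](mul0r (k%:R * (2 ^+ k * (1 + (2 * k)`!%:R * gauss_coef R (2 * k))))).
  apply: cvgM; first exact: des_scaleV_cvg0.
  apply: cvgM; first exact: cvg_cst.
  apply: cvgM; first exact: cvg_cst.
  by apply: cvgD; [exact: cvg_cst | exact: avg_sum_step_cvg].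
near=> n.
have s1 : 1 <= s n by apply: des_scale_ge1; near: n; exact: nbhs_infty_ge.
have s0 := des_scale_gt0 R n.
have O0 : (0 < #|Omega n|)%N by rewrite cardsT card_ffun !card_ord expn_gt0.
have sV1 : (s n)^-1 <= 1 by rewrite invf_le1.
have dle x : `|d n x| <= (s n)^-1.
  rewrite /d normrM [`|_^-1|]ger0_norm ?invr_ge0 ?(ltW s0) //.
  rewrite -[leRHS]mul1r ler_wpM2r ?invr_ge0 ?(ltW s0) //.
  by apply: drift_le1; have := nM n; lia.
rewrite /D -mulN1r -avgZ -avgD; apply: le_trans (avg_norm O0 _) _.
rewrite /b -[1 as X in X + avg _ _](avg_cst (R := R) O0) -avgD -!avgZ.
apply: avg_le => // x _; rewrite mulN1r.
apply: le_trans (expr_shift_bound _ _ _) _; first exact: le_trans (dle x) sV1.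
rewrite ler_pM ?mulr_ge0 ?exprn_ge0 ?addr_ge0 // ler_wpM2l //.
exact: expr_norm1_bound.
Unshelve. all: by end_near. Qed.

End ModelCvg.

Section ClassCvg.
Variables (R : realType) (la mu : nat -> seq nat).
Hypothesis hclass : forall n : nat, (0 < n)%N ->
  cycle_class n (la n) (mu n) \in classes (hyperoct n).
Hypothesis hla : forall i : nat, (count_mem i (la n))%:R @[n --> \oo] --> (0 : R).
Hypothesis hmu : forall i : nat, (count_mem i (mu n))%:R @[n --> \oo] --> (0 : R).

Local Notation C n := (cycle_class n (la n) (mu n)).
Local Notation s n := (des_scale R n).

Lemma natr_cvg0 (u : nat -> nat) : (u n)%:R @[n --> \oo] --> (0 : R) ->
  \forall n \near \oo, u n = 0%N.
Proof.
move=> /cvgrPdist_lt /(_ 1 ltr01); apply: filterS => n.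
by rewrite /= sub0r normrN ger0_norm // -[1]/(1%:R) ltr_nat ltnS leqn0 => /eqP.
Qed.

Lemma no_short_cycles m : \forall n \near \oo, forall i, (i <= m)%N ->
  count_mem i (la n) = 0%N /\ count_mem i (mu n) = 0%N.
Proof.
elim: m => [|m IH].
  near=> n => i; rewrite leqn0 => /eqP ->; split; near: n; exact: natr_cvg0.
near=> n => i; rewrite leq_eqVlt => /orP[/eqP ->|].
  by split; near: n; exact: natr_cvg0.
by rewrite ltnS; move: i; near: n.
Unshelve. all: by end_near. Qed.

Lemma near_long_cycles m : \forall n \near \oo, forall w, w \in C n -> long_cycles w m.
Proof.
near=> n => w; apply: long_cycles_class; near: n; exact: no_short_cycles.
Unshelve. all: by end_near. Qed.

Lemma avg_class_cvg k :
  avg (C n) (fun w => (((desB w)%:R - n%:R / 2) / s n) ^+ k) @[n --> \oo] -->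
  (k`!%:R * gauss_coef R k : R).
Proof.
(* The transfer error, at most 8 n^(k+2) / M, is then at most 4 / (n + 1). *)
pose M n := (4 * n ^ k.+3 + n + 1)%N.
pose om n := [set: {ffun 'I_n -> 'I_((M n).*2.+1)}]%SET.
pose a n := avg (C n) (fun w => (((desB w)%:R - n%:R / 2) / s n) ^+ k).
pose b n := avg (om n) (fun x => (((des_count (sample_key x))%:R - n%:R / 2) / s n) ^+ k).
rewrite (_ : (fun _ => _) = (fun n => (a n - b n) + b n)); last first.
  by apply/funext => n; rewrite subrK.
rewrite -[X in _ --> X]add0r; apply: cvgD; last first.
  by apply: avg_model_cvg => n; rewrite /M; lia.
apply: (@cvg0_dominated _ _ (fun n => 4 * @harmonic R n)); last first.
  by rewrite -[X in _ --> X](mulr0 4); apply: cvgM; [exact: cvg_cst | exact: cvg_harmonic].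
near=> n.
have n11 : (11 <= n)%N by near: n; exact: nbhs_infty_ge.
have s1 : 1 <= s n by exact: des_scale_ge1.
have s0 := des_scale_gt0 R n.
have Cl : forall w, w \in C n -> long_cycles w (2 * k) by near: n; exact: near_long_cycles.
have n0 : (0 < n)%N by lia.
have nk : (n ^ 2 <= n ^ k.+3)%N by rewrite leq_pexp2l.
have := @avg_class_model R n (M n) (la n) (mu n) k k (hclass n0) Cl _ (leqnn k).
have -> : ((2 * n) ^ 2 < M n)%N by rewrite /M expnMn; lia.
move=> /(_ isT) h.
rewrite /a /b /om.
have pull (T : finType) (S : {set T}) (f : T -> R) :
    avg S (fun x => (f x / s n) ^+ k) = (s n)^-1 ^+ k * avg S (fun x => f x ^+ k).
  by rewrite -avgZ; congr avg; apply/funext => x; rewrite exprMn mulrC.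
rewrite !pull -mulrBr normrM ger0_norm ?exprn_ge0 ?invr_ge0 ?(ltW s0) //.
apply: (@le_trans _ _ (1 * (2 * n%:R ^+ k * ((2 * n) ^ 2)%:R / (M n)%:R))).
  rewrite ler_pM ?exprn_ge0 ?invr_ge0 ?(ltW s0) //.
  by rewrite exprn_ile1 ?invr_ge0 ?(ltW s0) // invf_le1.
rewrite mul1r /harmonic /= ler_pdivrMr ?ltr0n; last by rewrite /M; lia.
rewrite [leRHS]mulrAC ler_pdivlMr // -natrX -!natrM ler_nat /M.
rewrite expnMn !expnS; set p := (n ^ k)%N; nia.
Unshelve. all: by end_near. Qed.

End ClassCvg.

(** * Exact mean and variance *)

Section UniformExpectation.
Variables (R : realType) (T : finType) (C : {set {perm T}}).
Hypothesis C0 : (0 < #|C|)%N.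
Local Notation P := (uniform_on R C).

Lemma uniform_on_set1 w : P [set w] = ((w \in C)%:R / #|C|%:R)%:E.
Proof.
rewrite uniform_onE //; congr (_%:R / _)%:E.
have [wC|wC] := boolP (w \in C).
  rewrite -[RHS](cards1 w); apply: eq_card => v; rewrite !inE.
  by apply/andP/eqP => [[_ /set_mem]|->] //; split => //; apply/mem_set.
apply/eqP; rewrite cards_eq0; apply/eqP/finset.setP => v; rewrite !inE.
by apply/negbTE/negP => /andP[vC /set_mem /= vw]; rewrite -vw vC in wC.
Qed.

Lemma expectation_uniform_on (X : {perm T} -> R) : ('E_P[X] = (avg C X)%:E)%E.
Proof.
have iI w : \1_[set w] \in Lfun P 1.
  by apply/Lfun1_integrable; exact: integrable_indic.
have iX w : (X w \o* \1_[set w]) \in Lfun P 1 by exact: Lfun_scale.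
(* A function on a finite type is a combination of indicators of points. *)
have -> : X = \sum_(f <- [seq X w \o* \1_[set w] | w <- enum {perm T}]) f.
  apply/funext => v; rewrite big_map fct_sumE big_enum /= (bigD1 v) //= big1 ?addr0.
    by rewrite /= indicE mem_set // mul1r.
  by move=> w wv; rewrite /= indicE memNset ?mul0r // => /esym/eqP; rewrite (negPf wv).
rewrite expectation_sum; last by move=> f /mapP[w _ ->].
rewrite big_map big_enum /=.
under eq_bigr => w _.
  rewrite expectationZl // expectation_indic // uniform_on_set1 -EFinM.
  over.
rewrite sumEFin /avg; congr (_%:E).
rewrite mulr_suml [RHS]big_mkcond /=; apply: eq_bigr => w _.
rewrite fct_sumE big_map big_enum /= (bigD1 w) //= big1 ?addr0; last first.
  by move=> v wv; rewrite /= indicE memNset ?mul0r // => /esym/eqP; rewrite (negPf wv).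
rewrite indicE mem_set // mul1r.
by case: (w \in C); rewrite ?mul1r ?mul0r ?mulr0.
Qed.

Lemma variance_uniform_on (X : {perm T} -> R) :
  ('V_P[X] = (avg C (fun w => (X w - avg C X) ^+ 2))%:E)%E.
Proof.
rewrite /variance unlock !expectation_uniform_on /=; congr (avg _ _)%:E.
Qed.

Lemma cdf_uniform_on (f : {perm T} -> R) x :
  cdf (perm_rv f : {RV P >-> R}) x = (avg C (fun w => (f w <= x)%R%:R))%:E.
Proof.
rewrite /cdf /distribution /pushforward uniform_onE //; congr (_ / _)%:E.
rewrite -sum1dep_card natr_sum [LHS]big_mkcondr /=; apply: eq_bigr => w _.
have -> : (w \in perm_rv f @^-1` `]-oo, x]%classic) = (f w <= x).
  by apply/idP/idP => [/set_mem|h]; rewrite ?mem_setE /= ?in_itv //=; apply/mem_set; rewrite /= in_itv.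
by case: ifP.
Qed.

End UniformExpectation.

Section ExactMoments.
Variables (R : realType) (n : nat) (la mu : seq nat).
Hypothesis n1 : (1 < n)%N.
Local Notation C := (cycle_class n la mu).
Hypothesis CH : C \in classes (hyperoct n).
Hypothesis Cl : forall w, w \in C -> long_cycles w (2 * 2).

(** Moments on the class do not depend on [M], so an error of order 1/M for all large [M] gives
    exact equalities. *)
Lemma eq0_le_divn (x c : R) m : (forall M, (m < M)%N -> `|x| <= c / M%:R) -> x = 0.
Proof.
move=> h; apply/eqP; rewrite -normr_le0 leNgt; apply/negP => x0.
have c0 : 0 <= c / `|x|.
  rewrite divr_ge0 //; have := le_trans (normr_ge0 x) (h m.+1 (ltnSn m)).
  by rewrite pmulr_lge0 // invr_gt0.
have := h (m + Num.bound (c / `|x|)).+1 _; rewrite ltnS leq_addr => /(_ isT).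
rewrite ler_pdivlMr // leNgt => /negP; apply.
rewrite mulrC -ltr_pdivrMr //; apply: lt_le_trans (archi_boundP c0) _.
by rewrite ler_nat; lia.
Qed.

Lemma avg_class1 : avg C (fun w => (desB w)%:R - n%:R / 2 : R) = 0.
Proof.
(* The constant adds the cost of conditioning on generic words and a bound for the bias n / (2N). *)
apply: (@eq0_le_divn _ (2 * n%:R * ((2 * n) ^ 2)%:R + n%:R) ((2 * n) ^ 2)) => M hM.
have := avg_class_model R CH Cl hM (isT : (1 <= 2)%N).
under eq_fun do rewrite expr1; under [X in _ - avg _ X]eq_fun do rewrite expr1.
rewrite avg_model1 // expr1 => h.
have M0 : 0 < M%:R :> R by rewrite ltr0n; lia.
have : `|n%:R / 2 / (M.*2.+1)%:R| <= n%:R / M%:R :> R.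
  rewrite ger0_norm ?divr_ge0 // ler_pM ?invr_ge0 //.
    by rewrite ler_pdivrMr // ler_peMr // ler1n.
  by rewrite lef_pV2 ?posrE // ler_nat; lia.
move=> h2; rewrite [leRHS]mulrDl; move: h h2.
set a := avg _ _; set b := n%:R / 2 / _; move=> h1 h2.
by have := ler_normB (a + b) b; rewrite addrK; rewrite opprK in h1; lra.
Qed.

Lemma avg_class2 : avg C (fun w => ((desB w)%:R - n%:R / 2) ^+ 2 : R) = n.+1%:R / 12.
Proof.
apply/eqP; rewrite -subr_eq0; apply/eqP.
apply: (@eq0_le_divn _ (2 * n%:R ^+ 2 * ((2 * n) ^ 2)%:R + (n.+1%:R + n%:R ^+ 2)) ((2 * n) ^ 2)) => M hM.
have := avg_class_model R CH Cl hM (isT : (2 <= 2)%N).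
rewrite avg_model2 //.
have M0 : 0 < M%:R :> R by rewrite ltr0n; lia.
have M1 : 1 <= M%:R :> R by rewrite ler1n; lia.
set a := avg _ _; set b := _ + _ ^+ 2 => h.
have : `|b - n.+1%:R / 12| <= (n.+1%:R + n%:R ^+ 2) / M%:R.
  rewrite /b step_moment2.
  have -> : (M.*2.+1)%:R = 2 * M%:R + 1 :> R by rewrite -natr1 -mul2n natrM.
  have NM : M%:R <= (2 * M%:R + 1) ^+ 2 :> R by nra.
  have N0 : 2 * M%:R + 1 != 0 :> R by rewrite gt_eqF //; lra.
  have -> : n.+1%:R * (((2 * M%:R + 1) ^+ 2 - 1) / (12 * (2 * M%:R + 1) ^+ 2)) +
      (n%:R / 2 / (2 * M%:R + 1)) ^+ 2 - n.+1%:R / 12 =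
      (n%:R ^+ 2 / 4 - n.+1%:R / 12) / (2 * M%:R + 1) ^+ 2 :> R.
    by move: N0; move: (2 * M%:R + 1) n.+1%:R n%:R => r p q r0; field.
  rewrite normrM [X in _ * X]ger0_norm ?invr_ge0 ?sqr_ge0 // ler_pM ?invr_ge0 ?sqr_ge0 //.
    have : 0 <= n%:R ^+ 2 :> R by rewrite sqr_ge0.
    have : 0 <= n.+1%:R :> R by [].
    by rewrite ler_norml; lra.
  by rewrite lef_pV2 ?posrE //; apply: lt_le_trans NM.
move=> h2; rewrite [leRHS]mulrDl.
have -> : a - n.+1%:R / 12 = (a - b) + (b - n.+1%:R / 12) by rewrite addrA subrK.
by apply: le_trans (ler_normD _ _) _; exact: lerD.
Qed.

End ExactMoments.

(** * Gaussian moments *)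

Section GaussExpectation.
Variable R : realType.
Local Notation mu := (@lebesgue_measure R).
Local Notation phi := (normal_pdf (0 : R) 1).
Implicit Types (f g : R -> R) (p q : {poly R}).

Definition gauss_integrable f := mu.-integrable setT (EFin \o (fun x => f x * phi x)).
Definition gauss_mean f : R := \int[mu]_x (f x * phi x).

Lemma phiE x : phi x = normal_peak 1 * expR (- x ^+ 2 / 2).
Proof. by rewrite /normal_pdf oner_eq0 /normal_fun subr0 expr1n. Qed.

Lemma phi_ge0 x : 0 <= phi x.
Proof. exact: normal_pdf_ge0. Qed.

Lemma measurable_phi : measurable_fun setT phi.
Proof. exact: measurable_normal_pdf. Qed.

(* Completing the square: the exponential tilt of the standard density is a
   multiple of a shifted one. *)
Lemma expR_phi c x : expR (c * x) * phi x = expR (c ^+ 2 / 2) * normal_pdf c 1 x.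
Proof.
rewrite phiE /normal_pdf oner_eq0 /normal_fun expr1n mulrCA [RHS]mulrCA -!expRD.
by congr (_ * expR _); field.
Qed.

Lemma gauss_integrable_expR c : gauss_integrable (fun x => expR (c * x)).
Proof.
rewrite /gauss_integrable (_ : _ \o _ = (fun x => (expR (c ^+ 2 / 2))%:E * (normal_pdf c 1 x)%:E)%E).
  by apply: integrableZl => //; exact: integrable_normal_pdf.
by apply/funext => x; rewrite /= expR_phi EFinM.
Qed.

Lemma gauss_integrableD f g : gauss_integrable f -> gauss_integrable g ->
  gauss_integrable (fun x => f x + g x).
Proof.
move=> fi gi; rewrite /gauss_integrable.
rewrite (_ : _ \o _ = (EFin \o (fun x => f x * phi x)) \+ (EFin \o (fun x => g x * phi x))).
  exact: integrableD.
by apply/funext => x; rewrite /= mulrDl EFinD.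
Qed.

Lemma gauss_integrableZ c f : gauss_integrable f -> gauss_integrable (fun x => c * f x).
Proof.
move=> fi; rewrite /gauss_integrable.
rewrite (_ : _ \o _ = (fun x => c%:E * (f x * phi x)%R%:E)%E).
  exact: integrableZl.
by apply/funext => x; rewrite /= -mulrA EFinM.
Qed.

Lemma gauss_integrable_le f g : measurable_fun setT f -> (forall x, `|f x| <= g x) ->
  gauss_integrable g -> gauss_integrable f.
Proof.
move=> mf fg; apply: le_integrable => //.
  by apply/measurable_EFinP; apply: measurable_funM => //; exact: measurable_phi.
move=> x _ /=; rewrite lee_fin !normrM ler_wpM2r //.
by rewrite (le_trans (fg x)) // ler_norm.
Qed.

Lemma expR_norm_le (x : R) : expR `|x| <= expR (1 * x) + expR (-1 * x).
Proof.
rewrite mul1r mulN1r; have [x0|x0] := leP 0 x.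
  by rewrite ger0_norm // lerDl expR_ge0.
by rewrite ltr0_norm // lerDr expR_ge0.
Qed.

Lemma expr_norm_le_expR (x : R) k : `|x| ^+ k <= k`!%:R * expR `|x|.
Proof.
case: k => [|k]; first by rewrite expr0 mul1r; apply: le_trans (expR_ge1Dx _); rewrite lerDl.
rewrite mulrC -ler_pdivrMr ?ltr0n ?fact_gt0 //.
by apply: le_trans (expR_ge1Dxn k (normr_ge0 x)); rewrite lerDr.
Qed.

(** Bounds |x|^i by i! exp |x|, so that polynomials inherit integrability from exponentials. *)
Lemma horner_le_expR p : exists2 c, 0 <= c & forall x, `|p.[x]| <= c * (expR (1 * x) + expR (-1 * x)).
Proof.
exists (\sum_(i < size p) `|p`_i| * i`!%:R); first by apply: sumr_ge0 => i _; rewrite mulr_ge0.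
move=> x; rewrite horner_coef mulr_suml (le_trans (ler_norm_sum _ _ _)) //.
apply: ler_sum => i _; rewrite normrM -mulrA ler_wpM2l // normrX.
by rewrite (le_trans (expr_norm_le_expR _ _)) // ler_wpM2l // expR_norm_le.
Qed.

Lemma measurable_horner p : measurable_fun setT (horner p).
Proof. by apply: continuous_measurable_fun; exact: continuous_horner. Qed.

Lemma gauss_integrable_horner p : gauss_integrable (horner p).
Proof.
have [c c0 pc] := horner_le_expR p.
apply: gauss_integrable_le pc _; first exact: measurable_horner.
by apply: gauss_integrableZ; apply: gauss_integrableD; exact: gauss_integrable_expR.
Qed.

Lemma gauss_integrable_hornerM p c :
  gauss_integrable (fun x => p.[x] * expR (c * x)).
Proof.
have [d d0 pd] := horner_le_expR p.
apply: (@gauss_integrable_le _ (fun x => d * (expR ((1 + c) * x) + expR ((-1 + c) * x)))).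
- apply: measurable_funM; first exact: measurable_horner.
  by apply: measurableT_comp => //; exact: measurable_funM.
- move=> x; rewrite normrM [X in _ * X]ger0_norm ?expR_ge0 //.
  by rewrite !mulrDl !expRD -mulrDl mulrA ler_wpM2r ?expR_ge0.
- by apply: gauss_integrableZ; apply: gauss_integrableD; exact: gauss_integrable_expR.
Qed.

Lemma gauss_meanD f g : gauss_integrable f -> gauss_integrable g ->
  gauss_mean (fun x => f x + g x) = gauss_mean f + gauss_mean g.
Proof.
move=> fi gi; rewrite /gauss_mean -RintegralD //; apply: eq_Rintegral => x _.
by rewrite mulrDl.
Qed.

Lemma gauss_meanZ c f : gauss_integrable f ->
  gauss_mean (fun x => c * f x) = c * gauss_mean f.
Proof.
move=> fi; rewrite /gauss_mean -RintegralZl //; apply: eq_Rintegral => x _.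
by rewrite mulrA.
Qed.

Lemma gauss_mean_le f g : gauss_integrable f -> gauss_integrable g ->
  (forall x, f x <= g x) -> gauss_mean f <= gauss_mean g.
Proof.
by move=> fi gi fg; apply: le_Rintegral => // x _; rewrite ler_wpM2r ?phi_ge0.
Qed.

Lemma gauss_mean_norm f : gauss_integrable f ->
  `|gauss_mean f| <= gauss_mean (fun x => `|f x|).
Proof.
move=> fi; apply: le_trans (le_normr_Rintegral _ fi) _ => //.
rewrite le_eqVlt; apply/orP; left; apply/eqP; apply: eq_Rintegral => x _.
by rewrite normrM (ger0_norm (phi_ge0 x)).
Qed.

Lemma gauss_mean1 : gauss_mean (fun=> 1) = 1.
Proof.
rewrite /gauss_mean /Rintegral.
under eq_integral do rewrite mul1r.
by rewrite integral_normal_pdf.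
Qed.

Lemma gauss_mean_indic x :
  gauss_mean (fun y => (y <= x)%R%:R) = fine (normal_prob (0 : R) 1 `]-oo, x]).
Proof.
rewrite /gauss_mean /normal_prob -[RHS]/(Rintegral _ _ _) [RHS]Rintegral_mkcond.
apply: eq_Rintegral => y _; rewrite patchE mem_setE /= in_itv /=.
by case: (y <= x); rewrite ?mul1r ?mul0r.
Qed.

Lemma gauss_integrable_indic x : gauss_integrable (fun y => (y <= x)%R%:R).
Proof.
apply: (@gauss_integrable_le _ (fun y => (1 : {poly R}).[y])); last exact: gauss_integrable_horner.
  rewrite (_ : (fun y => _) = \1_(`]-oo, x]%classic)); last first.
    by apply/funext => y; rewrite indicE mem_setE in_itv.
  by apply: measurable_indic.
by move=> y; rewrite hornerC; case: (y <= x); rewrite ?normr1 ?normr0.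
Qed.

Lemma gauss_mean_ext f g : f =1 g -> gauss_mean f = gauss_mean g.
Proof. by move=> fg; congr gauss_mean; apply/funext. Qed.

Lemma horner_powE k : (fun x : R => x ^+ k) = horner ('X^k : {poly R}).
Proof. by apply/funext => x; rewrite hornerXn. Qed.

Lemma gauss_mean_horner p n : (size p <= n)%N ->
  gauss_mean (horner p) = \sum_(i < n) p`_i * gauss_mean (fun x => x ^+ i).
Proof.
move=> pn; rewrite (gauss_mean_ext (g := fun x => \sum_(i < n) p`_i * x ^+ i)); last first.
  by move=> x; exact: horner_coef_wide.
have zi (s : seq 'I_n) : gauss_integrable (fun x => \sum_(i <- s) p`_i * x ^+ i).
  rewrite (_ : (fun x => _) = horner (\sum_(i <- s) p`_i *: 'X^i)); first exact: gauss_integrable_horner.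
  by apply/funext => x; rewrite horner_sum; apply: eq_bigr => i _; rewrite hornerZ hornerXn.
have xi i : gauss_integrable (fun x => x ^+ i) by rewrite horner_powE; exact: gauss_integrable_horner.
elim: (index_enum _) => [|i s IH].
  rewrite big_nil (gauss_mean_ext (g := fun x => 0 * 1)) => [|x]; last by rewrite big_nil mul0r.
  rewrite gauss_meanZ ?mul0r //; exact: (xi 0%N).
rewrite big_cons -IH -gauss_meanZ // -gauss_meanD //; last exact: gauss_integrableZ.
by apply: gauss_mean_ext => x; rewrite big_cons.
Qed.

(** From (|x| - 1)^2 >= 0 one gets |x| - x^2 / 2 <= 1/2. *)
Lemma expR_norm_phi_le x : expR `|x| * phi x <= normal_peak 1 * expR 2^-1.
Proof.
rewrite phiE mulrCA -expRD ler_wpM2l ?normal_peak_ge0 // ler_expR.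
have -> : x ^+ 2 = `|x| ^+ 2 by rewrite real_normK // num_real.
by have := sqr_ge0 (`|x| - 1); rewrite sqrrB1; lra.
Qed.

Lemma pow_phi_cvg0 k (u : nat -> R) : (forall n, `|u n| = n%:R) ->
  (u n ^+ k * phi (u n)) @[n --> \oo] --> (0 : R).
Proof.
(* [c] bounds |x|^(k+1) times the density; the extra power of |x| yields decay like 1/n. *)
move=> un; pose c := (k.+1)`!%:R * (normal_peak 1 * expR 2^-1) : R.
apply: (@cvg0_dominated _ _ (fun n => (2 * c) * @harmonic R n)); last first.
  rewrite -[X in _ --> X](mulr0 (2 * c)); apply: cvgM; [exact: cvg_cst | exact: cvg_harmonic].
near=> n.
have n1 : (0 < n)%N by near: n; exact: nbhs_infty_gt.
have n0 : 0 < n%:R :> R by rewrite ltr0n.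
have h : n%:R * `|u n ^+ k * phi (u n)| <= c.
  rewrite normrM normrX (ger0_norm (phi_ge0 _)) mulrA -{1}(un n) -exprS.
  apply: le_trans (ler_wpM2r (phi_ge0 _) (expr_norm_le_expR _ _)) _.
  by rewrite -mulrA ler_wpM2l // expR_norm_phi_le.
rewrite /harmonic /= ler_pdivlMr //.
have c0 : 0 <= c by rewrite mulr_ge0 // mulr_ge0 ?normal_peak_ge0 ?expR_ge0.
have : n.+1%:R <= 2 * n%:R :> R by rewrite -natrM ler_nat; lia.
move: h (normr_ge0 (u n ^+ k * phi (u n))); move: n.+1%:R (`|_|) => a b; nra.
Unshelve. all: by end_near. Qed.

Lemma is_derive_phi (x : R) : is_derive x (1 : R) phi (- x * phi x).
Proof.
pose q : {poly R} := (- 2^-1) *: 'X^2.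
have phiq : phi = normal_peak 1 *: (expR \o horner q).
  apply/funext => y; rewrite phiE /q [in RHS]/=; congr (_ * expR _).
  by rewrite /= hornerZ hornerXn; field.
rewrite {1}phiq; apply: is_derive_eq.
have -> : q^`().[x] = - x.
  by rewrite /q derivZ derivXn /= hornerZ hornerMn hornerX -mulr_natr; field.
rewrite phiE -[_ *: _]/(normal_peak 1 * (expR q.[x] * - x)) hornerZ hornerXn.
have -> : - 2^-1 * x ^+ 2 = - x ^+ 2 / 2 by field.
by ring.
Qed.

Lemma is_derive_pow_phi k (x : R) : is_derive x (1 : R) (fun y : R => y ^+ k * phi y)
  ((k%:R * x ^+ k.-1 - x ^+ k.+1) * phi x).
Proof.
have dp := is_derive_phi x.
rewrite (_ : (fun y => _) = horner ('X^k) * phi); last first.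
  by apply/funext => y; rewrite -[RHS]/(('X^k).[y] * phi y) hornerXn.
apply: is_derive_eq.
rewrite derivXn hornerMn !hornerXn /= exprS -mulr_natl /GRing.scale /=; ring.
Qed.

Lemma continuous_phi : continuous phi.
Proof. by apply: continuous_normal_pdf; exact: oner_neq0. Qed.

(* Integration by parts, i.e. Stein's identity for monomials. *)
Lemma gauss_mean_rec k :
  gauss_mean (fun x => x ^+ k.+1) = k%:R * gauss_mean (fun x => x ^+ k.-1).
Proof.
have xi i : gauss_integrable (fun x => x ^+ i) by rewrite horner_powE; exact: gauss_integrable_horner.
(* The derivative of x^k times the density; at k = 0 the truncated [k.-1] is harmless because its
   coefficient is 0. *)
pose f x := (k%:R * x ^+ k.-1 - x ^+ k.+1) * phi x.
have fi : mu.-integrable setT (EFin \o f).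
  have -> : EFin \o f = EFin \o (fun x => (k%:R * x ^+ k.-1 + -1 * x ^+ k.+1) * phi x).
    by apply/funext => x; rewrite /= /f mulN1r.
  exact: (gauss_integrableD (gauss_integrableZ k%:R (xi k.-1)) (gauss_integrableZ (-1) (xi k.+1))).
suff f0 : (\int[mu]_x (f x)%:E = 0)%E.
  have : gauss_mean (fun x => k%:R * x ^+ k.-1 + -1 * x ^+ k.+1) = 0.
    rewrite /gauss_mean /Rintegral.
    under eq_integral do rewrite mulN1r -/(f _).
    by rewrite f0.
  rewrite gauss_meanD ?gauss_meanZ //; [lra | exact: gauss_integrableZ | exact: gauss_integrableZ].
pose F x := x ^+ k * phi x.
have mf : measurable_fun setT (EFin \o f) by case/integrableP: fi.
(* Over these intervals the integral reduces to vanishing boundary terms; dominated convergence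
   passes to the line. The endpoint n + 1 avoids a degenerate interval at n = 0. *)
pose I n : set R := `[- n.+1%:R, n.+1%:R]%classic.
have mI n : measurable (I n) by exact: measurable_itv.
have cf : continuous f.
  have cp : continuous (fun y : R => k%:R * y ^+ k.-1 - y ^+ k.+1).
    rewrite (_ : (fun y => _) = horner (k%:R *: 'X^(k.-1) - ('X^(k.+1)))).
      exact: continuous_horner.
    by apply/funext => y; rewrite !hornerE.
  by move=> x; apply: cvgM; [exact: cp | exact: continuous_phi].
have Fn n : (\int[mu]_(x in I n) (f x)%:E = (F n.+1%:R)%:E - (F (- n.+1%:R))%:E)%E.
  apply: continuous_FTC2.
  - by apply: (@lt_trans _ _ 0); rewrite ?oppr_lt0 ?ltr0n.
  - exact: continuous_subspaceT.
  - have cF : continuous F.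
      move=> x; apply: differentiable_continuous; apply/derivable1_diffP.
      by have [] := is_derive_pow_phi k x.
    split.
    + by move=> x _; have [] := is_derive_pow_phi k x.
    + by apply: cvg_at_right_filter; exact: cF.
    + by apply: cvg_at_left_filter; exact: cF.
  - by move=> x _; rewrite derive1E; have [_ ->] := is_derive_pow_phi k x.
pose f_ n x : \bar R := ((EFin \o f) \_ (I n)) x.
have [||||_ _] := @dominated_convergence _ _ _ mu setT measurableT f_ (EFin \o f) (abse \o (EFin \o f)) _ mf.
- move=> n; apply/(measurable_restrictT _ (mI n)); exact: measurable_funTS.
- apply: aeW => x _; apply: cvg_near_cst; near=> n.
  rewrite /f_ patchE mem_set // /I /= in_itv /= -ler_norml.
  apply: (@le_trans _ _ n%:R); last by rewrite ler_nat.
  by near: n; exact: nbhs_infty_ger.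
- exact: integrable_abse.
- apply: aeW => x n _; rewrite /f_ patchE; case: ifP => //= _.
  by rewrite normr0 lee_fin.
move=> cv.
suff cv0 : (\int[mu]_x f_ n x)%E @[n --> \oo] --> (0 : \bar R)%E.
  exact: etrans (esym (cvg_lim (@ereal_hausdorff R) cv)) (cvg_lim (@ereal_hausdorff R) cv0).
rewrite (_ : (fun n => _) = (fun n => (F n.+1%:R - F (- n.+1%:R))%:E)); last first.
  by apply/funext => n; rewrite -integral_mkcond Fn.
apply: cvg_EFin; first by near=> n.
rewrite -[X in _ --> X](subr0 0); apply: cvgB.
  have h : F n%:R @[n --> \oo] --> (0 : R) by apply: pow_phi_cvg0 => n; exact: ger0_norm.
  by rewrite -cvg_shiftS in h; exact: h.
have h : F (- n%:R) @[n --> \oo] --> (0 : R).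
  by apply: pow_phi_cvg0 => n; rewrite normrN; exact: ger0_norm.
by rewrite -cvg_shiftS in h; exact: h.
Unshelve. all: by end_near. Qed.

(** The recursion jumps by two, so two consecutive moments are carried through the induction. *)
Lemma gauss_mean_pow k : gauss_mean (fun x => x ^+ k) = k`!%:R * gauss_coef R k.
Proof.
suff: gauss_mean (fun x => x ^+ k) = k`!%:R * gauss_coef R k /\
      gauss_mean (fun x => x ^+ k.+1) = k.+1`!%:R * gauss_coef R k.+1 by case.
elim: k => [|k [IH1 IH2]].
  split; last by rewrite gauss_mean_rec mul0r /gauss_coef /= mulr0.
  by rewrite (gauss_mean_ext (g := fun=> 1)) // gauss_mean1 /gauss_coef /= expr0 !mul1r invr1.
split => //; rewrite gauss_mean_rec /= IH1 /gauss_coef /= negbK.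
have [_|ko] := boolP (odd k); first by rewrite !mulr0.
have -> : (k.+2)`!%:R = 2 * (k./2).+1%:R * (k.+1%:R * k`!%:R) :> R.
  rewrite !factS !natrM; congr (_ * _); rewrite -natrM; congr (_%:R).
  by rewrite -{1}(even_halfK ko) -mul2n mulnS.
rewrite factS natrM exprS.
have f0 : (k./2)`!%:R != 0 :> R by rewrite pnatr_eq0 -lt0n fact_gt0.
have h0 : (k./2).+1%:R != 0 :> R by [].
move: f0 h0; move: ((k./2)`!%:R) ((k./2).+1%:R) => a b a0 b0.
by field; rewrite ?a0 ?b0.
Qed.

End GaussExpectation.

(** * The method of moments *)

Section SinTaylor.
Variable R : realType.
Implicit Types (f g : R -> R) (p q : {poly R}).

Lemma ge0_of_derive_ge0 g (dg : R -> R) : (forall x : R, is_derive x (1 : R) g (dg x)) ->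
  (forall x, 0 <= x -> 0 <= dg x) -> g 0 = 0 -> forall x, 0 <= x -> 0 <= g x.
Proof.
move=> gd dg0 g0 x x0.
have cg : {within `[0, x], continuous g}.
  apply: continuous_subspaceT => y; apply: differentiable_continuous.
  by apply/derivable1_diffP; have [] := gd y.
have [c c0x] := MVT_segment x0 (fun y _ => gd y) cg.
rewrite g0 !subr0 => ->; rewrite mulr_ge0 // dg0 //.
by move: c0x; rewrite in_itv /= => /andP[].
Qed.

(** [P] is an antiderivative of x^k / k!; both P + f and P - f have nonnegative derivative for x >=
    0. Negative x follows by reflection. *)
Lemma norm_le_of_derive_le f (df : R -> R) k : (forall x : R, is_derive x (1 : R) f (df x)) ->
  (forall x, `|df x| <= `|x| ^+ k / k`!%:R) -> f 0 = 0 ->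
  forall x, `|f x| <= `|x| ^+ k.+1 / k.+1`!%:R.
Proof.
pose P : {poly R} := (k.+1`!%:R)^-1 *: 'X^(k.+1).
have dP (x : R) : P^`().[x] = x ^+ k / k`!%:R.
  rewrite /P derivZ derivXn hornerZ hornerMn hornerXn /= -[x ^+ k *+ k.+1]mulr_natl factS natrM.
  have k0 : k.+1%:R != 0 :> R by [].
  have f0 : k`!%:R != 0 :> R by rewrite pnatr_eq0 -lt0n fact_gt0.
  by move: k0 f0; move: (k.+1%:R) (k`!%:R) (x ^+ k) => a b c a0 b0; field; rewrite ?a0 ?b0.
have P0 : P.[0] = 0 by rewrite /P hornerZ hornerXn expr0n mulr0.
have half g dg : (forall x : R, is_derive x (1 : R) g (dg x)) ->
    (forall x, `|dg x| <= `|x| ^+ k / k`!%:R) -> g 0 = 0 ->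
    forall x, 0 <= x -> `|g x| <= `|x| ^+ k.+1 / k.+1`!%:R.
  move=> gd dgb g0 x x0.
  have Px : `|x| ^+ k.+1 / k.+1`!%:R = P.[x] by rewrite ger0_norm // /P hornerZ hornerXn mulrC.
  rewrite Px ler_norml; apply/andP; split.
    rewrite lerNl -subr_ge0 opprK.
    apply: (@ge0_of_derive_ge0 (horner P + g) (fun x => P^`().[x] + dg x)) => // [y y0|].
      by have := dgb y; rewrite dP (ger0_norm y0) ler_norml => /andP[]; lra.
    by rewrite -[LHS]/(P.[0] + g 0) P0 g0 addr0.
  rewrite -subr_ge0.
  apply: (@ge0_of_derive_ge0 (horner P - g) (fun x => P^`().[x] - dg x)) => // [y y0|].
    by have := dgb y; rewrite dP (ger0_norm y0) ler_norml => /andP[]; lra.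
  by rewrite -[LHS]/(P.[0] - g 0) P0 g0 subr0.
move=> fd dfb f0 x; have [x0|x0] := leP 0 x; first exact: (half f df).
have := half (f \o -%R) (fun y => df (- y) * -1) _ _ _ (- x) _.
rewrite /= opprK normrN; apply => //.
- by move=> y; rewrite normrM normrN1 mulr1 -[`|y|]normrN; exact: dfb.
- by rewrite oppr0.
- by rewrite oppr_ge0 ltW.
Qed.

Lemma exists_antideriv p : exists2 P : {poly R}, deriv P = p & P.[0] = 0.
Proof.
pose P : {poly R} := \poly_(i < (size p).+1) (if i is j.+1 then p`_j / j.+1%:R else 0).
exists P; last by rewrite horner_coef0 coef_poly.
apply/polyP => i; rewrite coef_deriv coef_poly ltnS.
case: ltnP => ip; last by rewrite mul0rn nth_default.
by rewrite -[LHS]mulr_natr divfK.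
Qed.

Lemma sin_cos_taylor k : exists p q, forall x : R,
  `|sin x - p.[x]| <= `|x| ^+ k / k`!%:R /\ `|cos x - q.[x]| <= `|x| ^+ k / k`!%:R.
Proof.
elim: k => [|k [p [q pq]]].
  exists 0, 0 => x; rewrite !hornerC !subr0 expr0 divr1.
  by split; [exact: sin_max | exact: cos_max].
have [P dP P0] := exists_antideriv q; have [Q dQ Q0] := exists_antideriv p.
exists P, (1 - Q) => x; split.
  apply: (@norm_le_of_derive_le (sin - horner P) (fun x => cos x - P^`().[x])).
  - by move=> y; rewrite dP; have [] := pq y.
  - by rewrite -[LHS]/(sin 0 - P.[0]) sin0 P0 subr0.
rewrite -[X in `|X|]/((cos - horner (1 - Q)) x).
apply: (@norm_le_of_derive_le (cos - horner (1 - Q)) (fun x => - sin x - (1 - Q)^`().[x])).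
- move=> y; have -> : - sin y - (1 - Q)^`().[y] = - (sin y - p.[y]).
    by rewrite derivB derivC sub0r hornerN dQ; ring.
  by rewrite normrN; have [] := pq y.
- by rewrite -[LHS]/(cos 0 - (1 - Q).[0]) cos0 !hornerE Q0 subr0 subrr.
Qed.

End SinTaylor.

(** * Polynomial approximation of step functions *)

Section StepPolynomial.
Variable R : realType.

Lemma bernoulli_ineq (x : R) n : -1 <= x -> 1 + n%:R * x <= (1 + x) ^+ n.
Proof.
move=> x1; elim: n => [|n IH]; first by rewrite mul0r addr0 expr0.
rewrite exprS; apply: (@le_trans _ _ ((1 + x) * (1 + n%:R * x))); last by rewrite ler_wpM2l //; lra.
have : 0 <= n%:R * x ^+ 2 by rewrite mulr_ge0 // sqr_ge0.
by rewrite -natr1; move: n%:R => a; nra.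
Qed.

(** Take Q = (1 - t^n)^(2^n) with t = (1 + s) / 2. For s <= -d, Bernoulli gives Q >= 1 - (1 + s)^n.
    For d <= s, the product of Q and (1 + t^n)^(2^n) is at most 1, and Bernoulli bounds the second
    factor below by (1 + d)^n. *)
Lemma step_polynomial (d e : R) : 0 < d <= 1 -> 0 < e -> exists Q : {poly R},
  forall s, -1 <= s <= 1 ->
  [/\ 0 <= Q.[s] <= 1, s <= - d -> 1 - e <= Q.[s] & d <= s -> Q.[s] <= e].
Proof.
move=> /andP[d0 d1] e0.
(* Large enough for (1 + d)^n >= 1 / e. *)
pose n := Num.bound (e^-1 / d).
have nd : e^-1 <= 1 + n%:R * d.
  have := archi_boundP (ltW (divr_gt0 (_ : 0 < e^-1) d0)); rewrite invr_gt0 => /(_ e0).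
  by rewrite -/n ltr_pdivrMr // => h; lra.
have big : e^-1 <= (1 + d) ^+ n by apply: le_trans nd _; apply: bernoulli_ineq; lra.
have big0 : 0 < (1 + d) ^+ n by rewrite exprn_gt0 //; lra.
have small : ((1 + d) ^+ n)^-1 <= e by rewrite -[leRHS]invrK lef_pV2 ?posrE ?invr_gt0.
exists ((1 - (2^-1 *: (1 + 'X)) ^+ n) ^+ (2 ^ n)) => s /andP[s1 s2].
rewrite !(hornerE, horner_exp).
set t := 2^-1 * (1 + s).
have t0 : 0 <= t by rewrite /t; lra.
have t1 : t <= 1 by rewrite /t; lra.
have tn0 : 0 <= t ^+ n by rewrite exprn_ge0.
have tn1 : t ^+ n <= 1 by rewrite exprn_ile1.
have e2 : (2 ^ n)%:R * t ^+ n = (1 + s) ^+ n :> R.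
  by rewrite natrX -exprMn /t mulrA mulfV // mul1r.
split.
- by rewrite exprn_ge0 ?exprn_ile1 //; lra.
- move=> sd; apply: (@le_trans _ _ (1 + (2 ^ n)%:R * - t ^+ n)).
    rewrite mulrN e2 lerD2l lerN2; apply: le_trans small.
    rewrite -[leRHS]mul1r ler_pdivlMr // -exprMn exprn_ile1 //; first by rewrite mulr_ge0 //; lra.
    by nra.
  by apply: bernoulli_ineq; lra.
- move=> ds; apply: le_trans small; rewrite -[leRHS]mul1r ler_pdivlMr //.
  apply: (@le_trans _ _ ((1 - t ^+ n) ^+ (2 ^ n) * (1 + t ^+ n) ^+ (2 ^ n))).
    rewrite ler_wpM2l ?exprn_ge0 //; first by lra.
    apply: (@le_trans _ _ (1 + (2 ^ n)%:R * t ^+ n)); last by apply: bernoulli_ineq; lra.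
    rewrite e2; apply: (@le_trans _ _ ((1 + s) ^+ n)); last by rewrite lerDr.
    by rewrite lerXn2r ?nnegrE; lra.
  by rewrite -exprMn exprn_ile1 //; nra.
Qed.

End StepPolynomial.

Section PolynomialApproximation.
Variable R : realType.
Implicit Types (f g h : R -> R) (p q r : {poly R}).

(* The weight [q] is what makes the class stable under products with bounded
   factors: [|q| |f g - p p'| <= |q| |f - p| + |q p| |g - p'|] when [|g| <= 1]. *)
Definition poly_approx f := measurable_fun setT f /\
  forall q (e : R), 0 < e -> exists p r,
    (forall x, `|q.[x]| * `|f x - p.[x]| <= r.[x]) /\ gauss_mean (horner r) <= e.

Lemma gauss_mean_ge0 f : (forall x, 0 <= f x) -> 0 <= gauss_mean f.
Proof. by move=> f0; apply: Rintegral_ge0 => x _; rewrite mulr_ge0 // phi_ge0. Qed.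

Lemma poly_approx_horner p : poly_approx (horner p).
Proof.
split=> [|q e e0]; first exact: measurable_horner.
exists p, 0; split => [x|]; first by rewrite subrr normr0 mulr0 hornerC.
rewrite (gauss_mean_ext (g := fun=> 0 * 1)) => [|x]; last by rewrite hornerC mul0r.
rewrite gauss_meanZ ?mul0r ?ltW //.
rewrite (_ : (fun=> 1) = horner (1 : {poly R})); first exact: gauss_integrable_horner.
by apply/funext => x; rewrite hornerC.
Qed.

Lemma gauss_mean_hornerD p q :
  gauss_mean (horner (p + q)) = gauss_mean (horner p) + gauss_mean (horner q).
Proof.
rewrite -gauss_meanD; try exact: gauss_integrable_horner.
by apply: gauss_mean_ext => x; rewrite hornerD.
Qed.

Lemma poly_approxD f g : poly_approx f -> poly_approx g -> poly_approx (fun x => f x + g x).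
Proof.
move=> [mf fa] [mg ga]; split=> [|q e e0]; first exact: measurable_funD.
have e2 : 0 < e / 2 by rewrite divr_gt0.
have [p [r [pr re]]] := fa q _ e2; have [p' [r' [pr' re']]] := ga q _ e2.
exists (p + p'), (r + r'); split => [x|]; last by rewrite gauss_mean_hornerD; lra.
rewrite !hornerD; apply: le_trans (lerD (pr x) (pr' x)); rewrite -mulrDr ler_wpM2l //.
by rewrite opprD addrACA ler_normD.
Qed.

Lemma poly_approxM f g : poly_approx f -> poly_approx g -> (forall x, `|g x| <= 1) ->
  poly_approx (fun x => f x * g x).
Proof.
move=> [mf fa] [mg ga] g1; split=> [|q e e0]; first exact: measurable_funM.
have e2 : 0 < e / 2 by rewrite divr_gt0.
have [p [r [pr re]]] := fa q _ e2; have [p' [r' [pr' re']]] := ga (q * p) _ e2.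
exists (p * p'), (r + r'); split => [x|]; last by rewrite gauss_mean_hornerD; lra.
rewrite hornerD hornerM.
have -> : f x * g x - p.[x] * p'.[x] = (f x - p.[x]) * g x + p.[x] * (g x - p'.[x]) by ring.
apply: le_trans (ler_wpM2l _ (ler_normD _ _)) _ => //; rewrite mulrDr; apply: lerD.
  by apply: le_trans (pr x); rewrite normrM mulrA ler_piMr // mulr_ge0.
by apply: le_trans (pr' x); rewrite hornerM !normrM mulrA.
Qed.

(** Taylor approximation at even order 2K, so that the remainder bound is a polynomial; its Gaussian
    mean decays like 4^(-K) because |2z|^(2K) <= (2K)! exp |2z|. *)
Lemma poly_approx_sin (a b : R) : poly_approx (fun x => sin (a * x + b)).
Proof.
pose z : {poly R} := a *: 'X + b%:P.
have zE x : z.[x] = a * x + b by rewrite !hornerE.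
split=> [|q e e0].
  rewrite (_ : (fun x => _) = sin \o horner z); last by apply/funext => x; rewrite /= zE.
  apply: continuous_measurable_fun => x; apply: continuous_comp.
    exact: continuous_horner.
  exact: continuous_sin.
(* [w] is a polynomial above |q|, and [W] is an integrable majorant of w exp |2z|. *)
pose w := 1 + q ^+ 2.
pose W x := w.[x] * expR (2 * z.[x]) + w.[x] * expR (- 2 * z.[x]).
have WE x : W x = expR (2 * b) * (w.[x] * expR ((2 * a) * x)) +
    expR (- 2 * b) * (w.[x] * expR ((- 2 * a) * x)).
  by rewrite /W zE !mulrDr !expRD !mulrA; ring.
have Wi : gauss_integrable W.
  have -> : W = (fun x => expR (2 * b) * (w.[x] * expR ((2 * a) * x)) +
      expR (- 2 * b) * (w.[x] * expR ((- 2 * a) * x))) by apply/funext => x; exact: WE.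
  by apply: gauss_integrableD; apply: gauss_integrableZ; exact: gauss_integrable_hornerM.
have wE x : w.[x] = 1 + q.[x] ^+ 2 by rewrite /w hornerD hornerC horner_exp.
have w0 x : 0 <= w.[x] by rewrite wE addr_ge0 // sqr_ge0.
have qw x : `|q.[x]| <= w.[x].
  rewrite wE; have := sqr_ge0 (`|q.[x]| - 1).
  have -> : q.[x] ^+ 2 = `|q.[x]| ^+ 2 by rewrite real_normK // num_real.
  by have := normr_ge0 q.[x]; nra.
have W0 : 0 <= gauss_mean W.
  by apply: gauss_mean_ge0 => x; rewrite addr_ge0 // mulr_ge0 ?expR_ge0.
pose K := Num.bound (gauss_mean W / e).
have [p [p' pz]] := sin_cos_taylor R (2 * K).
exists (p \Po z), ((2 * K)`!%:R^-1 *: (w * z ^+ (2 * K))); split => [x|].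
  rewrite horner_comp -zE hornerZ hornerM horner_exp.
  have [pzx _] := pz z.[x].
  rewrite [leRHS]mulrCA ler_pM //.
  apply: le_trans pzx _; rewrite mulrC le_eqVlt; apply/orP; left; apply/eqP.
  by rewrite -normrX ger0_norm // exprM exprn_ge0 // sqr_ge0.
have K4 : 0 < 4 ^+ K :> R by rewrite exprn_gt0.
have rW x : ((2 * K)`!%:R^-1 *: (w * z ^+ (2 * K))).[x] <= (4 ^+ K)^-1 * W x.
  rewrite hornerZ hornerM horner_exp /W -mulrDr mulrCA [leRHS]mulrCA ler_wpM2l //.
  rewrite ler_pdivlMl // mulrCA ler_pdivrMl ?ltr0n ?fact_gt0 //.
  have -> : 4 ^+ K * z.[x] ^+ (2 * K) = `|2 * z.[x]| ^+ (2 * K).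
    rewrite -normrX ger0_norm; last by rewrite exprM exprn_ge0 // sqr_ge0.
    by rewrite exprMn [2 ^+ (2 * K)]exprM; congr (_ ^+ K * _); rewrite -natrX.
  apply: le_trans (expr_norm_le_expR _ _) _; rewrite ler_wpM2l //.
  by apply: le_trans (expR_norm_le _) _; rewrite mul1r mulN1r mulNr.
apply: (@le_trans _ _ (gauss_mean (fun x => (4 ^+ K)^-1 * W x))).
  apply: gauss_mean_le => //; first exact: gauss_integrable_horner.
  exact: gauss_integrableZ.
rewrite gauss_meanZ // mulrC ler_pdivrMr // mulrC -ler_pdivrMr //.
apply: (@le_trans _ _ K%:R); first by apply/ltW/archi_boundP; rewrite divr_ge0 // ltW.
by rewrite -natrX ler_nat ltnW // ltn_expl.
Qed.

Lemma poly_approx_horner_sin Q (a b : R) : poly_approx (fun x => Q.[sin (a * x + b)]).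
Proof.
elim/poly_ind: Q => [|Q c IH].
  rewrite (_ : (fun x => _) = horner 0); first exact: poly_approx_horner.
  by apply/funext => x; rewrite !hornerC.
rewrite (_ : (fun x => _) = (fun x => Q.[sin (a * x + b)] * sin (a * x + b) + (c%:P).[x])); last first.
  by apply/funext => x; rewrite !hornerE.
apply: poly_approxD; last exact: poly_approx_horner.
by apply: poly_approxM => //; [exact: poly_approx_sin | move=> x; exact: sin_max].
Qed.

Lemma sin_homo (a b : R) : - (pi / 2) <= a -> a <= b -> b <= pi / 2 -> sin a <= sin b.
Proof.
move=> a1 ab b1; move: ab; rewrite le_eqVlt => /orP[/eqP ->//|ab].
by rewrite ltW // ltr_sin ?in_itv //=; apply/andP; split => //; lra.
Qed.

(** The step is [Q] of the sine of a rescaled variable u. For |u| <= 1 the sine is increasing and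
    the composite is close to a step; for |u| > 1 the quadratic term u^2 takes over. *)
Lemma step_sandwich (x eta e : R) : 0 < eta -> 0 < e -> exists h r,
  [/\ poly_approx h,
     (forall y, (y <= x)%R%:R <= h y),
     (forall y, h y <= (y <= x + eta)%R%:R + r.[y]) & gauss_mean (horner r) <= e].
Proof.
move=> eta0 e0; pose c := x + eta / 2.
pose s : {poly R} := ('X - c%:P) ^+ 2.
have sE y : s.[y] = (y - c) ^+ 2 by rewrite horner_exp !hornerE.
have s0 : 0 <= gauss_mean (horner s).
  by apply: gauss_mean_ge0 => y; rewrite sE sqr_ge0.
(* L >= 1 + eta gives t <= 1/2, and the last summand makes the mean of s / L^2 at most e/4. *)
pose L := 1 + eta + 4 * gauss_mean (horner s) / e.
have V0 : 0 <= 4 * gauss_mean (horner s) / e by rewrite divr_ge0 ?mulr_ge0 // ltW.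
have L1 : 1 <= L by rewrite /L; lra.
have L0 : 0 < L by exact: lt_le_trans L1.
have Ls : 4 * gauss_mean (horner s) / e <= L ^+ 2.
  apply: (@le_trans _ _ L); first by rewrite /L lerDr; lra.
  by rewrite expr2 ler_peMr // ltW.
(* In the variable u the points x and x + eta become -t and t. *)
pose t := eta / 2 / L.
have t0 : 0 < t by rewrite !divr_gt0.
have t1 : t <= 1 / 2.
  rewrite ler_pdivrMr // /L.
  lra.
have pi2 : 1 <= pi / 2 :> R := pihalf_ge1 R.
have sint0 : 0 < sin t by apply: sin_gt0_pihalf; rewrite t0 /=; lra.
have sint1 : sin t <= 1 by exact: sin_le1.
have e4 : 0 < e / 4 by rewrite divr_gt0.
have [Q HQ] := @step_polynomial R (sin t) (e / 4) (introT andP (conj sint0 sint1)) e4.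
pose u y := (y - c) / L.
have uE y : L^-1 * y + (- c / L) = u y by rewrite /u mulrBl mulNr mulrC.
(* The constant e/4 absorbs the error of [Q]; each of the two copies of [v] in the bound has mean at
   most e/2. *)
pose v : {poly R} := (e / 4)%:P + (L ^- 2) *: s.
have vE y : v.[y] = e / 4 + u y ^+ 2.
  by rewrite hornerD hornerC hornerZ sE /u exprMn exprVn; congr (_ + _); exact: mulrC.
have Q01 y : 0 <= Q.[sin (u y)] <= 1.
  by have [] := HQ (sin (u y)); rewrite ?sin_geN1 ?sin_le1.
exists (fun y => Q.[sin (L^-1 * y + (- c / L))] + v.[y]), (v + v); split.
- apply: poly_approxD; [exact: poly_approx_horner_sin | exact: poly_approx_horner].
- move=> y; rewrite uE vE; have /andP[q0 q1] := Q01 y.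
  have u2 : 0 <= u y ^+ 2 by rewrite sqr_ge0.
  have [yx|_] := leP y x; last by rewrite /= !addr_ge0 // ltW.
  have [uy|uy] := leP (-1) (u y); last first.
    have h1 : 1 <= u y ^+ 2 by nra.
    by rewrite /=; lra.
  have ut : u y <= - t.
    by rewrite /u /t -mulNr ler_wpM2r ?invr_ge0 ?(ltW L0) // /c; lra.
  have [_ h _] := HQ (sin (u y)) (introT andP (conj (sin_geN1 _) (sin_le1 _))).
  have : sin (u y) <= sin (- t) by apply: sin_homo => //; lra.
  by rewrite sinN => /h /=; lra.
- move=> y; rewrite uE hornerD vE; have /andP[q0 q1] := Q01 y.
  have u2 : 0 <= u y ^+ 2 by rewrite sqr_ge0.
  have [yx|yx] := leP y (x + eta) => /=; first by lra.
  have [uy|uy] := leP (u y) 1; last first.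
    have h1 : 1 <= u y ^+ 2 by nra.
    by lra.
  have ut : t <= u y.
    by rewrite /u /t ler_wpM2r ?invr_ge0 ?(ltW L0) // /c; lra.
  have [_ _ h] := HQ (sin (u y)) (introT andP (conj (sin_geN1 _) (sin_le1 _))).
  have : sin t <= sin (u y) by apply: sin_homo => //; lra.
  by move=> /h; lra.
- rewrite gauss_mean_hornerD /v gauss_mean_hornerD.
  have -> : gauss_mean (horner (e / 4)%:P) = e / 4.
    rewrite (gauss_mean_ext (g := fun y => e / 4 * 1)) => [|y]; last by rewrite hornerC mulr1.
    rewrite gauss_meanZ ?gauss_mean1 ?mulr1 //.
    rewrite (_ : (fun=> 1) = horner (1 : {poly R})); first exact: gauss_integrable_horner.
    by apply/funext => y; rewrite hornerC.
  have -> : gauss_mean (horner (L ^- 2 *: s)) = gauss_mean (horner s) / L ^+ 2.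
    rewrite mulrC -gauss_meanZ; last exact: gauss_integrable_horner.
    by apply: gauss_mean_ext => y; rewrite hornerZ.
  have : gauss_mean (horner s) / L ^+ 2 <= e / 4.
    rewrite ler_pdivrMr ?exprn_gt0 //.
    move: Ls; rewrite ler_pdivrMr //; lra.
  lra.
Qed.

End PolynomialApproximation.

(** * From convergence of moments to convergence of distribution functions *)

Section MethodOfMoments.
Variables (R : realType) (T : nat -> finType) (S : forall n, {set T n}) (Y : forall n, T n -> R).
Hypothesis S0 : \forall n \near \oo, (0 < #|S n|)%N.
Hypothesis momY : forall k,
  avg (S n) (fun w => Y w ^+ k) @[n --> \oo] --> gauss_mean (fun x : R => x ^+ k).
Local Notation E n f := (avg (S n) (fun w => f (Y w))).

Lemma avg_horner_cvg (p : {poly R}) : E n (horner p) @[n --> \oo] --> gauss_mean (horner p).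
Proof.
rewrite (gauss_mean_horner (leqnn (size p))).
rewrite (_ : (fun n => _) = (fun n => \sum_(i < size p) p`_i * avg (S n) (fun w => Y w ^+ i))).
  by apply: cvg_sum_ord => i; apply: cvgM; [exact: cvg_cst | exact: momY].
apply/funext => n; rewrite /avg; under eq_bigr do rewrite horner_coef.
rewrite exchange_big /= mulr_suml; apply: eq_bigr => i _.
by rewrite -mulr_sumr mulrA.
Qed.

Lemma poly_approx_integrable (f : R -> R) : poly_approx f -> gauss_integrable f.
Proof.
move=> [mf fa]; have [p [r [pr _]]] := fa 1 1 ltr01.
have -> : f = (fun x => (f x - p.[x]) + p.[x]) by apply/funext => x; rewrite subrK.
apply: gauss_integrableD; last exact: gauss_integrable_horner.
apply: (gauss_integrable_le _ _ (gauss_integrable_horner r)).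
  by apply: measurable_funB => //; exact: measurable_horner.
by move=> x; have := pr x; rewrite hornerC normr1 mul1r.
Qed.

(** The approximation error is itself bounded by a polynomial [r] of small mean, whose averages
    converge as well. *)
Lemma avg_poly_approx_cvg (f : R -> R) : poly_approx f -> E n f @[n --> \oo] --> gauss_mean f.
Proof.
move=> fa; have fi := poly_approx_integrable fa; have [mf fap] := fa.
apply/cvgrPdist_le => e e0; have e4 : 0 < e / 4 by rewrite divr_gt0.
have [p [r [pr re]]] := fap 1 _ e4.
have pr1 x : `|f x - p.[x]| <= r.[x] by have := pr x; rewrite hornerC normr1 mul1r.
have gfp : `|gauss_mean f - gauss_mean (horner p)| <= e / 4.
  have pi := gauss_integrable_horner p.
  have di : gauss_integrable (fun x => f x + -1 * p.[x]).
    by apply: gauss_integrableD => //; exact: gauss_integrableZ.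
  rewrite -mulN1r -gauss_meanZ // -gauss_meanD //; last exact: gauss_integrableZ.
  apply: le_trans re; apply: le_trans (gauss_mean_norm di) _.
  apply: gauss_mean_le; last by move=> x; rewrite mulN1r.
    apply: (gauss_integrable_le _ _ (gauss_integrable_horner r)).
      apply: measurableT_comp => //; apply: measurable_funD => //.
      by apply: measurable_funM => //; exact: measurable_horner.
    by move=> x; rewrite normr_id mulN1r.
  exact: gauss_integrable_horner.
near=> n.
have n0 : (0 < #|S n|)%N by near: n.
have h1 : `|gauss_mean (horner p) - E n (horner p)| <= e / 4.
  by near: n; move/cvgrPdist_le: (@avg_horner_cvg p); apply.
have h2 : `|gauss_mean (horner r) - E n (horner r)| <= e / 4.
  by near: n; move/cvgrPdist_le: (@avg_horner_cvg r); apply.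
have h3 : `|E n f - E n (horner p)| <= E n (horner r).
  rewrite -mulN1r -avgZ -avgD; apply: le_trans (avg_norm n0 _) _.
  by apply: avg_le => // w _; rewrite mulN1r.
by move: gfp h1 h2 h3 re; rewrite !ler_norml => /andP[? ?] /andP[? ?] /andP[? ?] /andP[? ?] ?; apply/andP; split; lra.
Unshelve. all: by end_near. Qed.

Local Notation Phi := (fun x : R => gauss_mean (fun y => (y <= x)%R%:R)).

Lemma near_avg_cdf_le (x eta e : R) : 0 < eta -> 0 < e ->
  \forall n \near \oo, E n (fun y => (y <= x)%R%:R) <= Phi (x + eta) + e.
Proof.
move=> eta0 e0; have e2 : 0 < e / 2 by rewrite divr_gt0.
have [h [r [ha hl hu hr]]] := step_sandwich x eta0 e2.
have hi := poly_approx_integrable ha; have ri := gauss_integrable_horner r.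
have ii := @gauss_integrable_indic R (x + eta).
have hP : gauss_mean h <= Phi (x + eta) + e / 2.
  apply: (@le_trans _ _ (Phi (x + eta) + gauss_mean (horner r))); last by rewrite lerD2l.
  by rewrite -gauss_meanD //; apply: gauss_mean_le => //; exact: gauss_integrableD.
near=> n.
have n0 : (0 < #|S n|)%N by near: n.
have h1 : `|gauss_mean h - E n h| <= e / 2.
  by near: n; move/cvgrPdist_le: (avg_poly_approx_cvg ha); apply.
have h2 : E n (fun y => (y <= x)%R%:R) <= E n h by apply: avg_le.
by move: h1; rewrite ler_norml => /andP[? ?]; lra.
Unshelve. all: by end_near. Qed.

Lemma near_avg_cdf_ge (x eta e : R) : 0 < eta -> 0 < e ->
  \forall n \near \oo, Phi (x - eta) - e <= E n (fun y => (y <= x)%R%:R).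
Proof.
move=> eta0 e0; have e4 : 0 < e / 4 by rewrite divr_gt0.
(* The step is placed at x - eta so that its upper envelope is the indicator at x. *)
have [h [r [ha hl hu hr]]] := step_sandwich (x - eta) eta0 e4.
have hi := poly_approx_integrable ha.
have ii := @gauss_integrable_indic R (x - eta).
have hP : Phi (x - eta) <= gauss_mean h by exact: gauss_mean_le.
near=> n.
have n0 : (0 < #|S n|)%N by near: n.
have h1 : `|gauss_mean h - E n h| <= e / 4.
  by near: n; move/cvgrPdist_le: (avg_poly_approx_cvg ha); apply.
have h2 : `|gauss_mean (horner r) - E n (horner r)| <= e / 4.
  by near: n; move/cvgrPdist_le: (@avg_horner_cvg r); apply.
have h3 : E n h <= E n (fun y => (y <= x)%R%:R) + E n (horner r).
  by rewrite -avgD; apply: avg_le => // w _; have := hu (Y w); rewrite subrK.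
by move: h1 h2; rewrite !ler_norml => /andP[? ?] /andP[? ?]; lra.
Unshelve. all: by end_near. Qed.

Lemma method_of_moments (x : R) : {for x, continuous Phi} ->
  E n (fun y => (y <= x)%R%:R) @[n --> \oo] --> Phi x.
Proof.
move=> /cvgrPdist_lt cP; apply/cvgrPdist_le => e e0.
have e2 : 0 < e / 2 by rewrite divr_gt0.
have := cP _ e2; rewrite -nbhs_nearE => /nbhs_ballP[d /= d0 hd].
have d20 : 0 < d / 2 by rewrite divr_gt0.
have hl : `|Phi x - Phi (x - d / 2)| < e / 2.
  by apply: hd; rewrite /ball /= opprB addrC subrK ger0_norm ?ltW //; lra.
have hu : `|Phi x - Phi (x + d / 2)| < e / 2.
  by apply: hd; rewrite /ball /= opprD addrA subrr sub0r normrN ger0_norm ?ltW //; lra.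
near=> n.
have h1 : Phi (x - d / 2) - e / 2 <= E n (fun y => (y <= x)%R%:R).
  by near: n; exact: near_avg_cdf_ge.
have h2 : E n (fun y => (y <= x)%R%:R) <= Phi (x + d / 2) + e / 2.
  by near: n; exact: near_avg_cdf_le.
move: hl hu h1 h2; rewrite !ltr_norml ler_norml => /andP[? ?] /andP[? ?] ? ?.
by apply/andP; split; lra.
Unshelve. all: by end_near. Qed.

End MethodOfMoments.

(** * Mean, variance and asymptotic normality of descents on conjugacy classes *)

Theorem theorem1p3 (R : realType) (la mu : nat -> seq nat)
    (hclass : forall n : nat, (0 < n)%N ->
      cycle_class n (la n) (mu n) \in classes (hyperoct n))
    (hla : forall i : nat, (count_mem i (la n))%:R @[n --> \oo] --> (0 : R))
    (hmu : forall i : nat, (count_mem i (mu n))%:R @[n --> \oo] --> (0 : R)) :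
  let P (n : nat) := uniform_on R (cycle_class n (la n) (mu n)) in
  let X (n : nat) (w : {perm signed n}) : R := (desB w)%:R in
  (\forall n \near \oo,
      ('E_(P n)[X n] = (n%:R / 2)%:E)%E /\
      ('V_(P n)[X n] = (n.+1%:R / 12)%:E)%E)
  /\ @converges_in_distribution R _ _ P
      (fun n => perm_rv (fun w => (X n w - n%:R / 2) / Num.sqrt (n.+1%:R / 12)))
      (normal_prob (0 : R) 1).
Proof.
move=> P X.
have nonempty : \forall n \near \oo, (0 < #|cycle_class n (la n) (mu n)|)%N.
  by near=> n; apply/cycle_class_gt0/hclass; near: n; exact: nbhs_infty_gt.
split.
  near=> n.
  have n1 : (1 < n)%N by near: n; exact: nbhs_infty_gt.
  have C0 : (0 < #|cycle_class n (la n) (mu n)|)%N by near: n.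
  have CH := hclass n (ltnW n1).
  (* Cycles longer than 4 suffice for the moments of order at most 2. *)
  have Cl : forall w, w \in cycle_class n (la n) (mu n) -> long_cycles w (2 * 2).
    by near: n; exact: near_long_cycles.
  have mean : avg (cycle_class n (la n) (mu n)) (X n) = n%:R / 2.
    have := avg_class1 R n1 CH Cl; rewrite avgD avg_cst // => /eqP.
    by rewrite subr_eq0 => /eqP.
  split; first by rewrite expectation_uniform_on // mean.
  rewrite variance_uniform_on // mean; congr (_%:E).
  exact: avg_class2.
move=> x cx.
pose Y n (w : {perm signed n}) : R := ((desB w)%:R - n%:R / 2) / des_scale R n.
have Q01 y : normal_prob (0 : R) 1 `]-oo, y] \is a fin_num by apply: fin_num_measure.
have PhiE : (fun y : R => gauss_mean (fun z : R => (z <= y)%R%:R)) =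
    fine \o (fun y => normal_prob (0 : R) 1 `]-oo, y]).
  by apply/funext => y; exact: gauss_mean_indic.
(* Probabilities are finite, so continuity passes to real values through [fine]. *)
have cPhi : {for x, continuous (fun y : R => gauss_mean (fun z : R => (z <= y)%R%:R))}.
  rewrite PhiE; apply: fine_cvg; rewrite /= fineK //.
have h := @method_of_moments R _ (fun n => cycle_class n (la n) (mu n)) Y nonempty _ x cPhi.
rewrite [X in _ --> X](_ : _ = (gauss_mean (fun z : R => (z <= x)%R%:R))%:E); last first.
  by rewrite gauss_mean_indic; apply/esym/fineK.
(* The identity uses a nonempty class, hence holds eventually. *)
have E : \forall n \near \oo,
    (avg (cycle_class n (la n) (mu n)) (fun w => (Y n w <= x)%R%:R))%:E =
    cdf (perm_rv (fun w => (X n w - n%:R / 2) / Num.sqrt (n.+1%:R / 12)) : {RV (P n) >-> R}) x.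
  by near=> n; rewrite cdf_uniform_on //; near: n.
apply: cvg_trans (near_eq_cvg E) _.
apply: cvg_EFin; first by near=> n.
apply: h => k; rewrite gauss_mean_pow; exact: avg_class_cvg.
Unshelve. all: by end_near. Qed.
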